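(* Let $d=2m+1>1$ be an odd integer, let $\Lambda\subset G$ be a cocompact lattice obtained by the construction described in the context, and let $X_{d,\Lambda}=\Lambda\backslash G$ be the compact complex manifold obtained as the quotient of $G$ by the left action of $\Lambda$. Then there is no locally conformally Kähler (LCK) metric on $X_{d,\Lambda}$.
   Context: A Hermitian metric on a complex manifold is called locally conformally Kähler (LCK) if its associated form $\omega$ satisfies $d\omega=\theta\wedge\omega$ for some closed $1$-form $\theta$. The group $G$ and its complex structure. Let $m\ge 0$ and $d=2m+1$. For $\alpha'\in\mathbb{R}_{>0}$, $a=(a_1,\dots,a_d)\in\mathbb{R}^d$, $b=(b_1,\dots,b_d)\in\mathbb{R}^d$ and a real $d\times d$ array $c=(c_{ij})$, let $M(\alpha',a,b,c)$ be the $(2d+1)\times(2d+1)$ real matrix in block form $\begin{pmatrix} I_d & b & c\\ 0&\alpha'&a\\ 0&0&I_d\end{pmatrix}$, where $a$ is a row, $b$ a column, and the first $d$ rows are numbered from bottom to top: $b_i$ lies in row $d+1-i$, and $c_{ij}$ is the entry in the row containing $b_i$ and the column containing $a_j$. $G$ is the Lie group of all such matrices under matrix multiplication. Writing $\alpha'=w_2$, $(a_1,\dots,a_d)=(w_1,y_{01},x_{01},\dots,y_{0m},x_{0m})$, $b_i=y_{i0}$, $(c_{i1},\dots,c_{id})=(x_{i0},y_{i1},x_{i1},\dots,y_{im},x_{im})$ for $1\le i\le d$, the coordinates $w=w_1+\sqrt{-1}\,w_2$ and $z_{ij}=x_{ij}+\sqrt{-1}\,y_{ij}$ ($0\le i\le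 d$, $0\le j\le m$, $(i,j)\ne(0,0)$) identify $G$ with $\mathbb{H}\times\mathbb{C}^{(d+1)^2/2-1}$ ($\mathbb{H}$ the upper half plane); this makes $G$ a complex manifold on which left translations are holomorphic. Let $\mathcal{Z}=\{M(1,0,0,c)\}\cong\mathbb{R}^{d^2}$. Construction of $\Lambda$. (1) Pick $N=(n_{k,j})\in SL_{2d}(\mathbb{Z})$ diagonalizable over $\mathbb{R}$ with eigenvalues $\alpha$ and $1/\alpha$, each of multiplicity $d$, where $\alpha>1$ is a real quadratic algebraic integer. (2) Pick bases $(a_i^1,\dots,a_i^{2d})$, $1\le i\le d$, of the real eigenspace of $N$ (acting on column vectors) for $\alpha$, and $(b_i^1,\dots,b_i^{2d})$, $1\le i\le d$, of the real eigenspace for $1/\alpha$. (3) Put $e_{ij}^{s,t}=b_i^sa_j^t-a_j^sb_i^t$ and $z^{s,t}=M(1,0,0,(e_{ij}^{s,t}))$ for $1\le s,t\le 2d$. Pick any cocompact lattice $D$ of $\mathcal{Z}$ containing all $z^{s,t}$, with generators $h_k=M(1,0,0,(d_{ij}^k))$, $1\le k\le d^2$. (4) Pick any integer matrix $P=(p_{k,l})$ of size $2d\times d^2$. For each $i,j$ let $(c_{ij}^1,\dots,c_{ij}^{2d})$ be the unique solution of $c_{ij}^k=\sum_{s=1}^{2d}n_{k,s}c_{ij}^s+f_{ij}^k+\sum_{l=1}^{d^2}p_{k,l}d_{ij}^l$ ($1\le k\le 2d$), where $f_{ij}^k=\sum_{s=1}^{2d}\frac{n_{k,s}(n_{k,s}-1)}{2}b_i^sa_j^s+\sum_{1\le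 s<t\le 2d}n_{k,s}n_{k,t}b_i^sa_j^t$. (5) Put $g_k=M(1,(a_i^k)_i,(b_j^k)_j,(c_{ij}^k))$ for $1\le k\le 2d$, $g_0=M(\alpha,0,0,0)$, and $\Lambda=\langle g_0,g_1,\dots,g_{2d},h_1,\dots,h_{d^2}\rangle$. This is a discrete cocompact subgroup of $G$. *)

(* Defs.v *)
From HB Require Import structures.
From mathcomp Require Import all_boot all_order all_algebra.
From mathcomp Require Import all_classical all_reals all_analysis.
Set Implicit Arguments.
Unset Strict Implicit.
Unset Printing Implicit Defensive.
Import Order.TTheory GRing.Theory Num.Theory.
Import numFieldNormedType.Exports.
Local Open Scope classical_set_scope.
Local Open Scope ring_scope.

(* [cspace R p q] is the space of complex (p+1) x (q+1) arrays x + sqrt(-1) y,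
   seen as a real normed space: a point is the pair (x, y), and [Jmap] is the
   multiplication by sqrt(-1). *)
Notation cspace R p q := ('M[R]_(p.+1, q.+1) * 'M[R]_(p.+1, q.+1))%type.

Definition Jmap (R : realType) (p q : nat) (u : cspace R p q) : cspace R p q :=
  (- u.2, u.1).

(* For V open: f is of class C^k on V (the coordinate space has finite
   dimension, so directional derivatives along constant vectors suffice). *)
Fixpoint Ck (R : realType) (p q : nat) (k : nat) (V : set (cspace R p q))
    (f : cspace R p q -> R) : Prop :=
  if k is k'.+1 then
    (forall x, V x -> differentiable f x) /\
    (forall u : cspace R p q, Ck k' V (fun x => 'D_u f x))
  else forall x, V x -> {for x, continuous f}.

Definition smooth (R : realType) (p q : nat) (V : set (cspace R p q))
    (f : cspace R p q -> R) : Prop :=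
  forall k, Ck k V f.

(* A manifold is given by an atlas, i.e. a set of charts, on its set of points,
   which is part of a type T.  A chart is described by its inverse: an open set
   [cdom] of the coordinate space with an injective map [cpar] from [cdom] to
   the manifold. *)
Record chart (R : realType) (p q : nat) (T : Type) : Type := Chart {
  cdom : set (cspace R p q);
  cpar : cspace R p q -> T
}.

Definition transition (R : realType) (p q : nat) (T : Type)
    (c c' : chart R p q T) : cspace R p q -> cspace R p q :=
  'pinv_(fun=> 0) (cdom c') (cpar c') \o cpar c.

Definition transition_dom (R : realType) (p q : nat) (T : Type)
    (c c' : chart R p q T) : set (cspace R p q) :=
  cdom c `&` cpar c @^-1` (cpar c' @` cdom c').

(* A field of covariant tensors of degree 1, resp. 2, is given by its
   expressions in all the charts. *)
Definition tfield1 (R : realType) (p q : nat) (T : Type) : Type :=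
  chart R p q T -> cspace R p q -> cspace R p q -> R.

Definition tfield2 (R : realType) (p q : nat) (T : Type) : Type :=
  chart R p q T -> cspace R p q -> cspace R p q -> cspace R p q -> R.

Definition one_form (R : realType) (p q : nat) (T : Type)
    (A : set (chart R p q T)) (theta : tfield1 R p q T) : Prop :=
  [/\ forall c x, A c -> cdom c x ->
        forall (k : R) u u',
          theta c x (k *: u + u') = k * theta c x u + theta c x u',
      forall c, A c -> forall u, smooth (cdom c) (fun x => theta c x u)
    & forall c c', A c -> A c' -> forall x, transition_dom c c' x ->
        forall u, theta c x u =
          theta c' (transition c c' x) ('d (transition c c') x u)].

Definition hermitian_metric (R : realType) (p q : nat) (T : Type)
    (A : set (chart R p q T)) (g : tfield2 R p q T) : Prop :=
  [/\ forall c x, A c -> cdom c x ->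
        [/\ forall (k : R) u u' v,
              g c x (k *: u + u') v = k * g c x u v + g c x u' v,
            forall u v, g c x u v = g c x v u,
            forall u, u != 0 -> 0 < g c x u u
          & forall u v, g c x (Jmap u) (Jmap v) = g c x u v],
      forall c, A c -> forall u v, smooth (cdom c) (fun x => g c x u v)
    & forall c c', A c -> A c' -> forall x, transition_dom c c' x ->
        forall u v, g c x u v =
          g c' (transition c c' x) ('d (transition c c') x u)
                                   ('d (transition c c') x v)].

Definition fundamental_form (R : realType) (p q : nat) (T : Type)
    (g : tfield2 R p q T) : tfield2 R p q T :=
  fun c x u v => g c x (Jmap u) v.

(* Exterior derivatives and exterior product in a chart, evaluated on constant
   vector fields; both follow the normalisation without factorials, e.g.
   (theta /\ eta)(u, v) = theta(u) eta(v) - theta(v) eta(u). *)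
Definition ext_d1 (R : realType) (p q : nat)
    (theta : cspace R p q -> cspace R p q -> R)
    (x u v : cspace R p q) : R :=
  'D_u (fun y => theta y v) x - 'D_v (fun y => theta y u) x.

Definition ext_d2 (R : realType) (p q : nat)
    (omega : cspace R p q -> cspace R p q -> cspace R p q -> R)
    (x u v w : cspace R p q) : R :=
  'D_u (fun y => omega y v w) x - 'D_v (fun y => omega y u w) x
  + 'D_w (fun y => omega y u v) x.

Definition wedge12 (R : realType) (p q : nat)
    (theta : cspace R p q -> cspace R p q -> R)
    (omega : cspace R p q -> cspace R p q -> cspace R p q -> R)
    (x u v w : cspace R p q) : R :=
  theta x u * omega x v w - theta x v * omega x u w + theta x w * omega x u v.

Definition closed_one_form (R : realType) (p q : nat) (T : Type)
    (A : set (chart R p q T)) (theta : tfield1 R p q T) : Prop :=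
  one_form A theta /\
  forall c x, A c -> cdom c x -> forall u v, ext_d1 (theta c) x u v = 0.

Definition lck_metric (R : realType) (p q : nat) (T : Type)
    (A : set (chart R p q T)) (g : tfield2 R p q T) : Prop :=
  hermitian_metric A g /\
  exists2 theta : tfield1 R p q T, closed_one_form A theta &
    forall c x, A c -> cdom c x -> forall u v w,
      ext_d2 (fundamental_form g c) x u v w =
      wedge12 (theta c) (fundamental_form g c) x u v w.

Inductive generated (R : realType) (n : nat) (S : set 'M[R]_n) :
    set 'M[R]_n :=
  | generated_in g : S g -> generated S g
  | generated1 : generated S 1%:M
  | generatedM g h : generated S g -> generated S h -> generated S (g *m h)
  | generatedV g : generated S g -> generated S (invmx g).

(* D is a discrete subgroup of the matrix group H with D \ H compact. *)
Definition cocompact_lattice (R : realType) (n : nat) (H D : set 'M[R]_n) :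
    Prop :=
  [/\ [/\ D 1%:M, forall g h, D g -> D h -> D (g *m h)
        & forall g, D g -> D (invmx g)],
      D `<=` H,
      exists U : set 'M[R]_n, [/\ open U, U 1%:M & D `&` U `<=` [set 1%:M]]
    & exists K : set 'M[R]_n, [/\ compact K, K `<=` H
        & forall g, H g -> exists l k, [/\ D l, K k & g = l *m k]]].

(* The first d rows are numbered from bottom to top, hence [rev_ord]: row i of
   b and c is row d - 1 - i of the whole matrix, counting from 0. *)
Definition Gmx (R : realType) (d : nat) (alpha' : R) (a : 'rV[R]_d)
    (b : 'cV[R]_d) (c : 'M[R]_d) : 'M[R]_(d + (1 + d)) :=
  block_mx 1%:M
           (row_mx (\col_i b (rev_ord i) 0) (\matrix_(i, j) c (rev_ord i) j))
           0
           (block_mx alpha'%:M a 0 1%:M).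

Definition Zcenter (R : realType) (d : nat) : set 'M[R]_(d + (1 + d)) :=
  range (fun c : 'M[R]_d => Gmx 1 0 0 c).

(* Entry (i, j) of the coordinate array is z_ij, and entry (0, 0) is w.
   [coord_row z i] is (x_i0, y_i1, x_i1, ..., y_im, x_im) when d = 2m + 1; these
   are the entries of a for i = 0, and those of row i of c for i > 0. *)
Definition coord_row (R : realType) (d m : nat) (z : cspace R d m)
    (i : 'I_d.+1) (k : 'I_d) : R :=
  if odd k then z.2 i (inord (uphalf k)) else z.1 i (inord (uphalf k)).

Definition of_coord (R : realType) (d m : nat) (z : cspace R d m) :
    'M[R]_(d + (1 + d)) :=
  Gmx (z.2 ord0 ord0)
      (\row_k coord_row z ord0 k)
      (\col_i z.2 (lift ord0 i) ord0)
      (\matrix_(i, k) coord_row z (lift ord0 i) k).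

(* The points of L \ G are the cosets L g.  The charts are the local inverses
   of the projection from G, in the global coordinates of G. *)
Definition coset_of_coord (R : realType) (d m : nat)
    (L : set 'M[R]_(d + (1 + d))) (z : cspace R d m) :
    set 'M[R]_(d + (1 + d)) :=
  [set l *m of_coord z | l in L].

Definition quotient_atlas (R : realType) (d m : nat)
    (L : set 'M[R]_(d + (1 + d))) :
    set (chart R d m (set 'M[R]_(d + (1 + d)))) :=
  [set c : chart R d m _ | [/\ open (cdom c),
               cdom c `<=` [set z : cspace R d m | 0 < z.2 ord0 ord0],
               {in cdom c &, injective (coset_of_coord L)}
             & cpar c = coset_of_coord L]].

Definition quadratic_integer (R : realType) (alpha : R) : Prop :=
  exists P : {poly int},
    [/\ P \is monic, size P = 3%N,
        irreducible_poly (map_poly intr P : {poly rat})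
      & root (map_poly intr P) alpha].

(* The rows of B form a basis of the space of the v with A v = lambda v. *)
Definition eigenbasis (R : realType) (n k : nat) (A : 'M[R]_n) (lambda : R)
    (B : 'M[R]_(k, n)) : Prop :=
  row_free B /\ (B == eigenspace A^T lambda)%MS.

Definition emx (R : realType) (d : nat) (a b : 'M[R]_(d, 2 * d))
    (s t : 'I_(2 * d)) : 'M[R]_d :=
  \matrix_(i, j) (b i s * a j t - a j s * b i t).

Definition fmx (R : realType) (d : nat) (N : 'M[int]_(2 * d))
    (a b : 'M[R]_(d, 2 * d)) (k : 'I_(2 * d)) : 'M[R]_d :=
  \matrix_(i, j)
    (\sum_(s < 2 * d) (N k s * (N k s - 1))%:~R / 2 * (b i s * a j s)
     + \sum_(s < 2 * d) \sum_(t < 2 * d | (s < t)%N)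
         (N k s * N k t)%:~R * (b i s * a j t)).

Definition Lambda (R : realType) (d : nat) (alpha : R)
    (a b : 'M[R]_(d, 2 * d)) (c : 'I_(2 * d) -> 'M[R]_d)
    (h : 'I_(d ^ 2) -> 'M[R]_d) : set 'M[R]_(d + (1 + d)) :=
  generated ([set Gmx alpha 0 0 0]
    `|` range (fun k => Gmx 1 (col k a)^T (col k b) (c k))
    `|` range (fun k => Gmx 1 0 0 (h k))).

(* Main.v *)
Require Import Defs.
From HB Require Import structures.
From mathcomp Require Import all_boot all_order all_algebra.
From mathcomp Require Import all_classical all_reals all_analysis.
From mathcomp Require Import ring lra zify.
Set Implicit Arguments.
Unset Strict Implicit.
Unset Printing Implicit Defensive.
Import Order.TTheory GRing.Theory Num.Theory.
Import numFieldNormedType.Exports.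
Local Open Scope classical_set_scope.
Local Open Scope ring_scope.

(* Pull the metric and the Lee form theta back to the coordinates (t, a, b, c)
   of G, which range over the star-shaped set {t > 0}.  There theta = d phi, and
   exp(- phi) omega is closed.  Each lambda in Lambda changes phi by a constant
   l(lambda), and l is a homomorphism.  It vanishes on D: every C in D has all
   its multiples at bounded distance from integral combinations of the
   commutators z^{s,t}, so that n l(C) is bounded.  Hence the vector x of the
   l(g_k) satisfies N x = x, by conjugation with g_0, and x = 0 because 1 is not
   an eigenvalue of N.  So phi is invariant under the group generated by the g_k
   and D, which acts cocompactly on the slice t = 1.

   In that slice let r = b_1, s = a_2, q = c_12, y = c_13, so that J e_y = e_q,
   and let A = e_s + sum_i b_i d/dc_i2, an invariant field.  On the 4-dimensional
   subspace spanned by e_r, e_s, e_q, e_y, where A = e_s + b_1 e_q, closedness of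
   Omega = exp(- phi) omega says that the field with components Omega(A, y),
   - Omega(r, y), - b_1 Omega(r, y), Omega(r, A) has, up to sign, the divergence
   exp(- phi) g(e_q, e_q).  This is bounded below by some eps > 0, whereas
   Omega(A, y), Omega(r, y) and Omega(r, A) are bounded by some M, all by
   cocompactness.  On the box of sides l, l, l^2, l the average of the divergence
   is at most 8 M / l, which is absurd for large l. *)

(** The divergence formula is a Lie algebra obstruction in disguise. If Omega were invariant under
    the whole group acting on the slice, closedness on the invariant fields e_r, A, e_y would reduce
    to Omega([e_r, A], e_y) = 0, because e_y is central. But [e_r, A] = e_q = J e_y, so the left
    side is a squared length up to sign. The actual metric is invariant only under a lattice, so
    this term has to be isolated by averaging; on large boxes the flux through the faces grows more
    slowly than the volume.

    The obstacle is the Lee potential phi: it may change under g_0, and without further knowledge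
    also under the g_k, and then Omega would not be bounded. The invariance under g_0 is never
    obtained. Instead all four directions of the box are tangent to the slice t = 1, where only the
    g_k and D are needed; for these, the absence of the eigenvalue 1 of N excludes a change of phi.

    The hypothesis d > 1 provides the columns 2 and 3 of c: c_12 and c_13 are the imaginary and the
    real part of one complex coordinate, which gives J e_y = e_q. *)

Section MatrixNorm.
Variable R : realType.

Lemma ler_mx_norm m n (A : 'M[R]_(m, n)) i j : `|A i j| <= `|A|.
Proof. by rewrite [leRHS]/Num.norm /= mx_normrE (le_bigmax _ _ (i, j)). Qed.

Lemma mx_norm_le m n (A : 'M[R]_(m, n)) M :
  0 <= M -> (forall i j, `|A i j| <= M) -> `|A| <= M.
Proof.
move=> M0 AM; rewrite /Num.norm /= mx_normrE.
by apply/bigmax_leP; split=> // -[i j] _; exact: AM.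
Qed.

Lemma mulmx_norm_le m n p (A : 'M[R]_(m, n)) (B : 'M[R]_(n, p)) :
  `|A *m B| <= n%:R * (`|A| * `|B|).
Proof.
apply: mx_norm_le => [|i j]; first by rewrite mulr_ge0 // mulr_ge0.
rewrite mxE (le_trans (ler_norm_sum _ _ _)) //.
rewrite (le_trans (ler_sum _ (_ : forall k, _ -> _ <= `|A| * `|B|))) //.
  by move=> k _; rewrite normrM ler_pM // ler_mx_norm.
by rewrite sumr_const card_ord mulr_natl.
Qed.

Lemma trmx_norm m n (A : 'M[R]_(m, n)) : `|A^T| = `|A|.
Proof.
have le p q (B : 'M[R]_(p, q)) : `|B^T| <= `|B|.
  by apply: mx_norm_le => // i j; rewrite mxE ler_mx_norm.
by apply/eqP; rewrite eq_le le /= -{1}[A]trmxK le.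
Qed.

End MatrixNorm.

(** * The group law of G in the entries (alpha', a, b, c) *)

Section MatrixGroup.
Variables (R : realType) (d : nat).
Implicit Types (x : R) (a : 'rV[R]_d) (b : 'cV[R]_d) (c : 'M[R]_d).

(** Isolates the numbering of the rows from bottom to top. It commutes with right multiplication, so
    that [Gmx_mul] bears no trace of it. *)
Definition flipmx n (c : 'M[R]_(d, n)) : 'M[R]_(d, n) :=
  \matrix_(i, j) c (rev_ord i) j.

Lemma GmxE x a b c :
  Gmx x a b c = block_mx 1%:M (row_mx (flipmx b) (flipmx c)) 0
                  (block_mx x%:M a 0 1%:M).
Proof.
rewrite /Gmx; congr block_mx; congr row_mx.
by apply/matrixP => i j; rewrite !mxE ord1.
Qed.

Lemma flipmxD n (c c' : 'M[R]_(d, n)) : flipmx (c + c') = flipmx c + flipmx c'.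
Proof. by apply/matrixP => i j; rewrite !mxE. Qed.

Lemma flipmxM n p (c : 'M[R]_(d, n)) (c' : 'M[R]_(n, p)) :
  flipmx (c *m c') = flipmx c *m c'.
Proof. by apply/matrixP => i j; rewrite !mxE; apply: eq_bigr => k _; rewrite mxE. Qed.

Lemma flipmxK n : involutive (@flipmx n).
Proof. by move=> c; apply/matrixP => i j; rewrite !mxE rev_ordK. Qed.

Lemma Gmx_mul x a b c x' a' b' c' :
  Gmx x a b c *m Gmx x' a' b' c' =
  Gmx (x * x') (x *: a' + a) (b' + x' *: b) (c' + b *m a' + c).
Proof.
rewrite !GmxE mulmx_block !mul1mx !mulmx0 !mul0mx !add0r !addr0 mul_row_block.
rewrite mulmx0 addr0 mulmx1 add_row_mx mulmx_block !mul0mx !mulmx0 !mulmx1.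
rewrite !addr0 !add0r -scalar_mxM mul_scalar_mx mul_mx_scalar.
rewrite !flipmxD -flipmxM addrA; congr (block_mx _ (row_mx (_ + _) _) _ _).
by apply/matrixP => i j; rewrite !mxE.
Qed.

Lemma Gmx_inj x a b c x' a' b' c' : Gmx x a b c = Gmx x' a' b' c' ->
  [/\ x = x', a = a', b = b' & c = c'].
Proof.
rewrite !GmxE => /eq_block_mx[_ /eq_row_mx[/(can_inj (@flipmxK _)) ->]].
move=> /(can_inj (@flipmxK _)) -> _ /eq_block_mx[/matrixP/(_ 0 0) + -> _ _].
by rewrite !mxE.
Qed.

Lemma Gmx1 : Gmx 1 0 0 0 = 1%:M :> 'M[R]_(d + (1 + d)).
Proof.
rewrite GmxE; have f0 n : flipmx 0 = 0 :> 'M[R]_(d, n).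
  by apply/matrixP => i j; rewrite !mxE.
by rewrite !f0 row_mx0 -!scalar_mx_block.
Qed.

Lemma Gmx_mulV x a b c : x != 0 ->
  Gmx x a b c *m Gmx x^-1 (- x^-1 *: a) (- x^-1 *: b) (x^-1 *: (b *m a) - c) =
  1%:M.
Proof.
move=> x0; rewrite Gmx_mul divff // scalerA mulrN divff // scaleN1r addNr.
by rewrite scaleNr addNr -scalemxAr scaleNr addrAC subrK addrN Gmx1.
Qed.

Lemma Gmx_unit x a b c : x != 0 -> Gmx x a b c \in unitmx.
Proof. by move=> x0; have [] := mulmx1_unit (Gmx_mulV a b c x0). Qed.

Lemma Gmx_inv x a b c : x != 0 ->
  invmx (Gmx x a b c) =
  Gmx x^-1 (- x^-1 *: a) (- x^-1 *: b) (x^-1 *: (b *m a) - c).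
Proof.
move=> x0; rewrite -[RHS](mulKmx (Gmx_unit a b c x0)).
by rewrite Gmx_mulV // mulmx1.
Qed.

Lemma Gmx_dist1 c : `|Gmx 1 0 0 0 - Gmx 1 0 0 c| <= `|c|.
Proof.
rewrite !GmxE opp_block_mx add_block_mx !addrN opp_row_mx add_row_mx addrN.
apply: mx_norm_le => // i j; rewrite mxE; case: splitP => i' _; rewrite mxE.
  case: splitP => j' _; first by rewrite mxE normr0.
  rewrite mxE; case: splitP => k _; rewrite !mxE ?normr0 //.
  by rewrite sub0r normrN ler_mx_norm.
by case: splitP => j' _; rewrite mxE normr0.
Qed.

Lemma Gmx_coef_norm x a b c : `|c| <= `|Gmx x a b c|.
Proof.
apply: mx_norm_le => // i j.
have -> : c i j = Gmx x a b c (lshift _ (rev_ord i)) (rshift d (rshift 1 j)).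
  by rewrite GmxE block_mxEur row_mxEr mxE rev_ordK.
exact: ler_mx_norm.
Qed.

End MatrixGroup.

(** * The quadratic expressions behind f_ij^k *)

Section Quadratic.
Variables (R : realType) (n : nat).

Lemma sum_trichotomy (F : 'I_n -> 'I_n -> R) :
  \sum_s \sum_t F s t = \sum_s F s s + \sum_(s < n) \sum_(t < n | (s < t)%N) F s t
                        + \sum_(s < n) \sum_(t < n | (t < s)%N) F s t.
Proof.
rewrite -!big_split /=; apply: eq_bigr => s _.
rewrite (bigD1 s) //= -addrA; congr (_ + _).
rewrite (bigID (fun t : 'I_n => (s < t)%N)) /=; congr (_ + _);
  apply: eq_bigl => t; rewrite -val_eqE /=; by case: ltngtP.
Qed.

(* With beta = b_i, gamma = a_j and x = row k of N this is f_ij^k. *)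
Definition quadform (beta gamma x : 'I_n -> R) : R :=
  \sum_s x s * (x s - 1) / 2 * (beta s * gamma s)
  + \sum_(s < n) \sum_(t < n | (s < t)%N) x s * x t * (beta s * gamma t).

(** Up to a linear term, [quadform] is an entry of the c-part of the ordered product of the powers
    of g_1, g_2, ... with exponents x. To reorder the product of two such words, each g_t with
    exponent y_t has to pass every g_s with t < s, and this costs the commutator terms of the last
    sum. *)
Lemma quadformD (beta gamma x y : 'I_n -> R) :
  quadform beta gamma (fun s => x s + y s) =
  quadform beta gamma x + quadform beta gamma y
  + (\sum_s beta s * x s) * (\sum_t gamma t * y t)
  - \sum_(s < n) \sum_(t < n | (t < s)%N)
      x s * y t * (beta s * gamma t - gamma s * beta t).
Proof.
have -> : (\sum_s beta s * x s) * (\sum_t gamma t * y t) =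
    \sum_s \sum_t x s * y t * (beta s * gamma t).
  rewrite mulr_suml; apply: eq_bigr => s _; rewrite mulr_sumr.
  by apply: eq_bigr => t _; ring.
rewrite sum_trichotomy /quadform.
have -> : \sum_(s < n) \sum_(t < n | (t < s)%N)
      x s * y t * (beta s * gamma t - gamma s * beta t) =
    \sum_(s < n) \sum_(t < n | (t < s)%N) x s * y t * (beta s * gamma t)
    - \sum_(s < n) \sum_(t < n | (s < t)%N) x t * y s * (beta s * gamma t).
  rewrite [X in _ - X](exchange_big_dep predT) //= -sumrB.
  apply: eq_bigr => s _; rewrite -sumrB; apply: eq_bigr => t _; ring.
have -> : \sum_(s < n) \sum_(t < n | (s < t)%N)
      (x s + y s) * (x t + y t) * (beta s * gamma t) =
    \sum_(s < n) \sum_(t < n | (s < t)%N) x s * x t * (beta s * gamma t)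
    + \sum_(s < n) \sum_(t < n | (s < t)%N) y s * y t * (beta s * gamma t)
    + \sum_(s < n) \sum_(t < n | (s < t)%N) x s * y t * (beta s * gamma t)
    + \sum_(s < n) \sum_(t < n | (s < t)%N) x t * y s * (beta s * gamma t).
  rewrite -!big_split /=; apply: eq_bigr => s _.
  by rewrite -!big_split /=; apply: eq_bigr => t _; ring.
have -> : \sum_s (x s + y s) * (x s + y s - 1) / 2 * (beta s * gamma s) =
    \sum_s x s * (x s - 1) / 2 * (beta s * gamma s)
    + \sum_s y s * (y s - 1) / 2 * (beta s * gamma s)
    + \sum_s x s * y s * (beta s * gamma s).
  by rewrite -!big_split /=; apply: eq_bigr => s _; field.
ring.
Qed.

End Quadratic.

(** Properties of exponent vectors are thereby reduced to the unit vectors, that is, to the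
    generators g_k. *)
Lemma int_cV_ind n (S : 'cV[int]_n -> Prop) :
  S 0 -> (forall v w, S v -> S w -> S (v + w)) -> (forall v, S v -> S (- v)) ->
  (forall k, S (delta_mx k 0)) -> forall v, S v.
Proof.
move=> S0 SD SN Sdelta v; rewrite [v]matrix_sum_delta.
apply: (big_ind S S0 SD) => k _; rewrite big_ord1.
have Sn m : S (delta_mx k 0 *+ m).
  by elim: m => [|m IH]; [rewrite mulr0n|rewrite mulrS; apply: (SD _ _ (Sdelta k))].
rewrite -[X in X *: _]intz scaler_int.
by case: (v k 0) => m; [exact: Sn|rewrite NegzE mulrNz; apply/SN/Sn].
Qed.

(** * The lattice *)

Section Lattice.
Variables (R : realType) (d : nat) (N : 'M[int]_(2 * d)) (alpha : R).
Hypothesis hdet : \det N = 1.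
Hypothesis hchar : char_poly (map_mx intr N : 'M[R]_(2 * d)) =
           ('X - alpha%:P) ^+ d * ('X - alpha^-1%:P) ^+ d.
Hypothesis halpha : 1 < alpha.
Variables (a b : 'M[R]_(d, 2 * d)).
Hypothesis ha : eigenbasis (map_mx intr N) alpha a.
Hypothesis hb : eigenbasis (map_mx intr N) alpha^-1 b.
Variables (D : set 'M[R]_(d + (1 + d))) (h : 'I_(d ^ 2) -> 'M[R]_d).
Hypothesis hD : cocompact_lattice (@Zcenter R d) D.
Hypothesis hDz : forall s t : 'I_(2 * d), D (Gmx 1 0 0 (emx a b s t)).
Hypothesis hDgen : D = generated (range (fun k => Gmx 1 0 0 (h k))).
Variables (P : 'M[int]_(2 * d, d ^ 2)) (c : 'I_(2 * d) -> 'M[R]_d).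
Hypothesis hc : forall (k : 'I_(2 * d)) (i j : 'I_d),
    c k i j = \sum_s (N k s)%:~R * c s i j + fmx N a b k i j
              + \sum_l (P k l)%:~R * h l i j.

Let alpha_gt0 : 0 < alpha. Proof. exact: lt_trans halpha. Qed.
Let alpha_neq0 : alpha != 0. Proof. by rewrite gt_eqF. Qed.

Notation realv := (map_mx intr : 'cV[int]_(2 * d) -> 'cV[R]_(2 * d)).

Definition Dcoef (delta : 'M[R]_d) : Prop := D (Gmx 1 0 0 delta).

Lemma Dcoef0 : Dcoef 0.
Proof. by rewrite /Dcoef Gmx1; case: hD => -[]. Qed.

Lemma DcoefD x y : Dcoef x -> Dcoef y -> Dcoef (x + y).
Proof.
move=> Dx Dy; have [[_ hM _] _ _ _] := hD; have := hM _ _ Dx Dy.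
by rewrite /Dcoef Gmx_mul mulr1 !scaler0 mulmx0 !addr0 (addrC y).
Qed.

Lemma DcoefN x : Dcoef x -> Dcoef (- x).
Proof.
move=> Dx; have [[_ _ hV] _ _ _] := hD; have := hV _ Dx.
by rewrite /Dcoef Gmx_inv ?oner_neq0 // invr1 !scaler0 mulmx0 scaler0 add0r.
Qed.

Lemma DcoefMz x (n : int) : Dcoef x -> Dcoef (n%:~R *: x).
Proof.
move=> Dx; have Dn k : Dcoef (k%:R *: x).
  elim: k => [|k IH]; first by rewrite scale0r; exact: Dcoef0.
  by rewrite -natr1 scalerDl scale1r; exact: DcoefD.
case: n => k; first exact: Dn.
by rewrite NegzE mulrNz scaleNr; apply/DcoefN/Dn.
Qed.

Lemma Dcoef_sum I (r : seq I) (Q : pred I) (F : I -> 'M[R]_d) :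
  (forall i, Q i -> Dcoef (F i)) -> Dcoef (\sum_(i <- r | Q i) F i).
Proof. by move=> hF; apply: big_ind; [exact: Dcoef0|exact: DcoefD|]. Qed.

Lemma Dcoef_h l : Dcoef (h l).
Proof. by rewrite /Dcoef hDgen; apply: generated_in; exists l. Qed.

Definition quad (v : 'cV[R]_(2 * d)) : 'M[R]_d :=
  \sum_s v s 0 *: c s
  + \matrix_(i, j) quadform (b i) (a j) (fun s => v s 0).

Ltac mxring :=
  repeat match goal with
  | |- context [?u *m ?v] => let y := fresh in set y := (u *m v); move: y => y
  | |- context [quad ?v] => let y := fresh in set y := (quad v); move: y => y
  end;
  apply/matrixP => ? ?; rewrite !mxE; ring.

Lemma quadE v i j : quad v i j =
  \sum_s v s 0 * c s i j + quadform (b i) (a j) (fun s => v s 0).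
Proof. by rewrite !(mxE, summxE); under eq_bigr do rewrite mxE. Qed.

(** The failure of [quad] to be additive is the cocycle of the group law, up to an integral
    combination of the z^{s,t}, which lie in D. This is what makes [nilgrp] closed under products
    and inverses. *)
Lemma quadD (v w : 'cV[int]_(2 * d)) :
  Dcoef (quad (realv v) + quad (realv w) + (b *m realv v) *m (a *m realv w)^T
         - quad (realv (v + w))).
Proof.
have -> : quad (realv v) + quad (realv w) + b *m realv v *m (a *m realv w)^T
         - quad (realv (v + w)) =
   \sum_(s < 2 * d) \sum_(t < 2 * d | (t < s)%N) (v s 0 * w t 0)%:~R *: emx a b s t.
  apply/matrixP => i j; rewrite /quad !(mxE, summxE).
  under [X in _ = X]eq_bigr do rewrite summxE.
  have -> : quadform (b i) (a j) (fun s => map_mx intr (v + w) s 0) =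
      quadform (b i) (a j) (fun s => realv v s 0 + realv w s 0).
    by congr quadform; apply/funext => s; rewrite !mxE rmorphD.
  rewrite quadformD big_ord1 !mxE.
  have -> : \sum_s (map_mx intr (v + w) s 0 *: c s) i j =
      \sum_s (realv v s 0 *: c s) i j + \sum_s (realv w s 0 *: c s) i j.
    by rewrite -big_split; apply: eq_bigr => s _; rewrite !mxE rmorphD mulrDl.
  have -> : \sum_(s < 2 * d) \sum_(i0 < 2 * d | (i0 < s)%N)
      ((v s 0 * w i0 0)%:~R *: emx a b s i0) i j =
     \sum_(s < 2 * d) \sum_(t < 2 * d | (t < s)%N) realv v s 0 * realv w t 0 *
      (b i s * a j t - a j s * b i t).
    by do 2!(apply: eq_bigr => ? _); rewrite !mxE rmorphM.
  ring.
apply: Dcoef_sum => s _; apply: Dcoef_sum => t _; apply: DcoefMz.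
exact: hDz.
Qed.

(* (A, B, C) satisfies [nilgrp] when M(1, A, B, C) is in the group generated by
   the g_k and D; [quad v] is, modulo D, the c-part of the product of the g_k
   with exponents v. *)
Definition nilgrp (A : 'rV[R]_d) (B : 'cV[R]_d) (C : 'M[R]_d) : Prop :=
  exists v : 'cV[int]_(2 * d),
    [/\ A = (a *m realv v)^T, B = b *m realv v & Dcoef (C - quad (realv v))].

(** The triple in the conclusion is that of M(1, A, B, C) M(1, A', B', C'). *)
Lemma nilgrpM A B C A' B' C' : nilgrp A B C -> nilgrp A' B' C' ->
  nilgrp (A' + A) (B' + B) (C' + B *m A' + C).
Proof.
move=> [v [-> -> hC]] [w [-> -> hC']]; exists (v + w).
rewrite map_mxD !mulmxDr linearD /=; split; [exact: addrC|exact: addrC|].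
have -> : C' + b *m realv v *m (a *m realv w)^T + C - quad (realv v + realv w) =
  (C' - quad (realv w)) + (C - quad (realv v)) + (quad (realv v) + quad (realv w)
   + (b *m realv v) *m (a *m realv w)^T - quad (realv (v + w))).
  rewrite map_mxD; by mxring.
by apply: DcoefD; [exact: DcoefD|exact: quadD].
Qed.

Lemma quad0 : quad 0 = 0.
Proof.
apply/matrixP => i j; rewrite /quad !(mxE, summxE) /quadform.
rewrite !big1 ?addr0 // => s _; rewrite ?mxE ?mul0r //.
by rewrite big1 // => t _; rewrite !mxE !mul0r.
Qed.

Lemma nilgrp0 C : Dcoef C -> nilgrp 0 0 C.
Proof.
move=> DC; exists 0; have -> : realv 0 = 0 by apply/matrixP => i j; rewrite !mxE.
by rewrite !mulmx0 trmx0 quad0 subr0.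
Qed.

Lemma nilgrpV A B C : nilgrp A B C -> nilgrp (- A) (- B) (B *m A - C).
Proof.
move=> [v [-> -> hC]]; exists (- v).
have -> : realv (- v) = - realv v by apply/matrixP => i j; rewrite !mxE rmorphN.
rewrite !mulmxN linearN /=; split=> //.
have := quadD v (- v); rewrite subrr.
have -> : realv 0 = 0 by apply/matrixP => i j; rewrite !mxE.
have -> : realv (- v) = - realv v by apply/matrixP => i j; rewrite !mxE rmorphN.
rewrite quad0 subr0 mulmxN linearN /= mulmxN => /DcoefD/(_ hC)/DcoefN.
congr Dcoef; mxring.
Qed.

Let trN_unit : N^T \in unitmx. Proof. by rewrite unitmx_tr unitmxE hdet. Qed.

Lemma eigenvec_a : a *m map_mx intr N^T = alpha *: a.
Proof.
case: ha => _ /andP[/eigenspaceP]; rewrite -map_trmx => -> //.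
Qed.

Lemma eigenvec_b : b *m map_mx intr N^T = alpha^-1 *: b.
Proof.
case: hb => _ /andP[/eigenspaceP]; rewrite -map_trmx => -> //.
Qed.

(** The eigenvalues on the a-part and on the b-part are inverse to each other, so the cocycle does
    not see N. *)
Lemma bilinear_conj (v w : 'cV[int]_(2 * d)) :
  b *m realv (N^T *m v) *m (a *m realv (N^T *m w))^T =
  b *m realv v *m (a *m realv w)^T.
Proof.
rewrite !map_mxM !mulmxA eigenvec_a eigenvec_b -!scalemxAl linearZ /=.
by rewrite -scalemxAr scalerA mulVf // scale1r.
Qed.

Let Dq (v : 'cV[int]_(2 * d)) :=
  Dcoef (quad (realv (N^T *m v)) - quad (realv v)).

Let DqD v w : Dq v -> Dq w -> Dq (v + w).
Proof.
move=> Dv Dw; have := quadD (N^T *m v) (N^T *m w).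
rewrite bilinear_conj -mulmxDr => /DcoefN/DcoefD/(_ (quadD v w)).
move=> /DcoefD/(_ Dv)/DcoefD/(_ Dw); rewrite /Dq; congr Dcoef.
by mxring.
Qed.

Lemma quad_delta k : quad (realv (delta_mx k 0)) = c k.
Proof.
have dk s : realv (delta_mx k 0) s 0 = (s == k)%:R.
  by rewrite !mxE eqxx andbT; case: eqP.
apply/matrixP => i j; rewrite quadE.
  have -> : \sum_s realv (delta_mx k 0) s 0 * c s i j = c k i j.
    rewrite (bigD1 k) //= dk eqxx mul1r big1 ?addr0 // => s /negPf sk.
    by rewrite dk sk mul0r.
  have -> : quadform (b i) (a j) (fun s => realv (delta_mx k 0) s 0) = 0.
    rewrite /quadform big1 => [|s _]; last first.
      by rewrite dk; case: eqP => _; rewrite ?subrr ?mulr0 !mul0r.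
    rewrite add0r big1 // => s _; rewrite big1 // => t st; rewrite !dk.
    case: (s =P k) => [sk|_]; last by rewrite !mul0r.
    by rewrite -val_eqE /= gtn_eqF ?mulr0 ?mul0r // -sk.
by rewrite addr0.
Qed.

(** For the k-th unit vector this is the equation that determines c^k. It extends to all integer
    vectors because [quad] has the same defect of additivity before and after applying N^T, by
    [bilinear_conj]. *)
Lemma quad_conj (v : 'cV[int]_(2 * d)) :
  Dcoef (quad (realv (N^T *m v)) - quad (realv v)).
Proof.
have Dq0 : Dq 0.
  by rewrite /Dq mulmx0 subrr; exact: Dcoef0.
have DqN w : Dq w -> Dq (- w).
  move=> Dw; have := quadD (N^T *m w) (N^T *m - w).
  rewrite bilinear_conj -mulmxDr => Dw1.
  have := DcoefD (DcoefD Dw1 (DcoefN (quadD w (- w)))) (DcoefN Dw).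
  rewrite /Dq subrr mulmx0; congr Dcoef.
  by mxring.
have Dqk k : Dq (delta_mx k 0).
  rewrite /Dq.
  have -> : quad (realv (N^T *m delta_mx k 0)) - quad (realv (delta_mx k 0)) =
      \sum_l (- P k l)%:~R *: h l.
    have Nk s : realv (N^T *m delta_mx k 0) s 0 = (N k s)%:~R.
      by rewrite -colE !mxE.
    apply/matrixP => i j; rewrite quad_delta mxE [X in _ + X = _]mxE quadE summxE.
    have -> : (fun s => realv (N^T *m delta_mx k 0) s 0) =
        (fun s => (N k s)%:~R) by apply/funext => s.
    under eq_bigr do rewrite Nk.
    have fE : fmx N a b k i j = quadform (b i) (a j) (fun s => (N k s)%:~R).
      rewrite mxE /quadform; congr (_ + _); apply: eq_bigr => s _.
        by rewrite rmorphM rmorphB.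
      by apply: eq_bigr => t _; rewrite rmorphM.
    rewrite hc fE; under [RHS]eq_bigr do rewrite mxE rmorphN mulNr.
    by rewrite sumrN; ring.
  by apply: Dcoef_sum => l _; apply/DcoefMz/Dcoef_h.
exact: (int_cV_ind Dq0 DqD DqN Dqk).
Qed.

(** Conjugation by g_0, which acts on exponent vectors as N^T. *)
Lemma nilgrp_conj A B C : nilgrp A B C -> nilgrp (alpha *: A) (alpha^-1 *: B) C.
Proof.
move=> [v [-> -> hC]]; exists (N^T *m v).
rewrite !map_mxM !mulmxA eigenvec_a eigenvec_b -!scalemxAl linearZ /=; split=> //.
have := DcoefD hC (DcoefN (quad_conj v)); congr Dcoef; rewrite map_mxM.
by mxring.
Qed.

(** Here the inverse of N^T has to be integral, which det N = 1 ensures. *)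
Lemma nilgrp_conjV A B C :
  nilgrp A B C -> nilgrp (alpha^-1 *: A) (alpha *: B) C.
Proof.
move=> [v [-> -> hC]].
have [w vE] : exists w, v = N^T *m w by exists (invmx N^T *m v); rewrite mulKVmx.
exists w; rewrite vE !map_mxM !mulmxA eigenvec_a eigenvec_b -!scalemxAl linearZ /=.
rewrite !scalerA mulVf // mulfV // !scale1r; split=> //.
have := DcoefD hC (quad_conj w); congr Dcoef; rewrite vE.
by mxring.
Qed.

Lemma nilgrp_conj_exp (n : int) A B C :
  nilgrp A B C -> nilgrp (alpha ^ n *: A) (alpha ^ (- n) *: B) C.
Proof.
move=> H; have Hn k : nilgrp (alpha ^ k%:Z *: A) (alpha ^ (- k%:Z) *: B) C.
  elim: k => [|k /nilgrp_conj]; first by rewrite oppr0 !expr0z !scale1r.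
  by rewrite !scalerA -!exprnN -!exprnP -invfM -exprS.
have HVn k : nilgrp (alpha ^ (- k%:Z) *: A) (alpha ^ k%:Z *: B) C.
  elim: k => [|k /nilgrp_conjV]; first by rewrite oppr0 !expr0z !scale1r.
  by rewrite !scalerA -!exprnN -!exprnP -invfM -exprS.
case: n => k; first exact: Hn.
by rewrite NegzE opprK; exact: HVn.
Qed.

(** A normal form g_0^n M(1, A, B, C): powers of g_0 can be moved to the left because conjugation by
    g_0 preserves [nilgrp]. *)
Lemma Lambda_nilgrp g : Lambda alpha a b c h g ->
  exists n A B C, nilgrp A B C /\ g = Gmx (alpha ^ n) (alpha ^ n *: A) B C.
Proof.
elim=> {g} [g [[->|[k _ <-]]|[l _ <-]]||g g' _ [n [A [B [C [H ->]]]]]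
             _ [n' [A' [B' [C' [H' ->]]]]]|g _ [n [A [B [C [H ->]]]]]].
- exists 1, 0, 0, 0; rewrite scaler0 expr1z; split=> //.
  by apply/nilgrp0/Dcoef0.
- exists 0, (col k a)^T, (col k b), (c k); rewrite expr0z scale1r; split=> //.
  exists (delta_mx k 0); rewrite quad_delta subrr map_delta_mx -!colE; split=> //.
  exact: Dcoef0.
- exists 0, 0, 0, (h l); rewrite expr0z scale1r; split=> //.
  by apply/nilgrp0/Dcoef_h.
- exists 0, 0, 0, 0; rewrite expr0z scale1r Gmx1; split=> //.
  by apply/nilgrp0/Dcoef0.
- exists (n + n'), (A' + alpha ^ (- n') *: A), (B' + alpha ^ n' *: B).
  exists (C' + (alpha ^ n' *: B) *m A' + C); split.
    by apply: nilgrpM => //; have := nilgrp_conj_exp (- n') H; rewrite opprK.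
  rewrite Gmx_mul scalerDr scalerA -!expfzDr // addrK scalerA.
  by rewrite -expfzDr // -scalemxAl -scalemxAr.
- exists (- n), (alpha ^ n *: - A), (alpha ^ (- n) *: - B), (B *m A - C); split.
    exact/nilgrp_conj_exp/nilgrpV.
  rewrite Gmx_inv ?expfz_neq0 // -invr_expz -scalemxAr !scalerA mulNr.
  by rewrite mulVf ?expfz_neq0 // !scale1r scaleN1r scalerN scaleNr.
Qed.

Lemma nilgrp_Lambda A B C : nilgrp A B C -> Lambda alpha a b c h (Gmx 1 A B C).
Proof.
have LD delta : Dcoef delta -> Lambda alpha a b c h (Gmx 1 0 0 delta).
  rewrite /Dcoef hDgen; elim=> [g [l _ <-]||g g' _ Lg _ Lg'|g _ Lg].
  - by apply: generated_in; right; exists l.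
  - exact: generated1.
  - exact: generatedM.
  - exact: generatedV.
(* One admissible C for each exponent vector is enough: two of them differ by an element of D. *)
pose S v := exists C, Lambda alpha a b c h (Gmx 1 (a *m realv v)^T (b *m realv v) C)
  /\ Dcoef (C - quad (realv v)).
have S0 : S 0.
  exists 0; have -> : realv 0 = 0 by apply/matrixP => i j; rewrite !mxE.
  by rewrite !mulmx0 trmx0 quad0 subr0; split; [apply: LD|]; exact: Dcoef0.
have SD v w : S v -> S w -> S (v + w).
  move=> [X [LX DX]] [Y [LY DY]]; exists (Y + b *m realv v *m (a *m realv w)^T + X).
  split.
    rewrite map_mxD !mulmxDr linearD /=; have := generatedM LX LY.
    by rewrite Gmx_mul mul1r !scale1r addrC (addrC (b *m _)).
  have := DcoefD (DcoefD DX DY) (quadD v w); congr Dcoef.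
  by mxring.
have SN v : S v -> S (- v).
  move=> [X [LX DX]]; have rN : realv (- v) = - realv v.
    by apply/matrixP => i j; rewrite !mxE rmorphN.
  exists (b *m realv v *m (a *m realv v)^T - X); split.
    have := generatedV LX; rewrite Gmx_inv ?oner_neq0 // invr1 !scaleN1r scale1r.
    by rewrite rN !mulmxN linearN.
  have := DcoefN (DcoefD DX (quadD v (- v))).
  rewrite subrr; have -> : realv 0 = 0 by apply/matrixP => i j; rewrite !mxE.
  rewrite quad0 rN mulmxN linearN /= mulmxN; congr Dcoef.
  by mxring.
have Sdelta k : S (delta_mx k 0).
  exists (c k); rewrite quad_delta subrr map_delta_mx -!colE.
  split; last exact: Dcoef0.
  by apply: generated_in; left; right; exists k.
have Sv := int_cV_ind S0 SD SN Sdelta.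
move=> [v [-> -> DC]]; have [X [LX DX]] := Sv v.
have /generatedM/(_ LX) : Lambda alpha a b c h (Gmx 1 0 0 (C - X)).
  apply: LD; have := DcoefD DC (DcoefN DX); congr Dcoef.
  by mxring.
by rewrite Gmx_mul mulr1 scale1r scaler0 !addr0 mul0mx addr0 addrC subrK.
Qed.

(** The two eigenspaces meet only in 0 and their dimensions add up to 2d, so the rows of a and b
    form a basis; U and V are the blocks of the inverse matrix. They recover an exponent vector from
    its (A, B) as U A^T + V B. *)
Lemma eigenbasis_inv : exists U V : 'M[R]_(2 * d, d),
  [/\ a *m U = 1%:M, a *m V = 0, b *m U = 0, b *m V = 1%:M
    & U *m a + V *m b = 1%:M].
Proof.
have neq : alpha != alpha^-1.
  rewrite gt_eqF // (@lt_trans _ _ 1) // invf_lt1 //.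
have rk : \rank (col_mx a b) = (d + d)%N.
  rewrite -addsmxE mxrank_disjoint_sum; first by case: ha hb => /eqP -> _ [/eqP -> _].
  apply/eqP/rowV0P => v; rewrite sub_capmx => /andP[va vb].
  have {}va : v *m (map_mx intr N)^T = alpha *: v.
    by apply/eigenspaceP/(submx_trans va); case: ha => _ /andP[].
  have {}vb : v *m (map_mx intr N)^T = alpha^-1 *: v.
    by apply/eigenspaceP/(submx_trans vb); case: hb => _ /andP[].
  move/eqP: vb; rewrite va -subr_eq0 -scalerBl scaler_eq0 subr_eq0.
  by rewrite (negPf neq) => /eqP.
have fr : row_free (col_mx a b) by rewrite /row_free rk.
have fu : row_full (col_mx a b) by rewrite /row_full rk mul2n addnn.
have := mulmxVp fr; have := mulVpmx fu.
set W := pinvmx _; rewrite -[W]hsubmxK mul_row_col => H1.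
rewrite mul_col_row scalar_mx_block => /eq_block_mx[E1 E2 E3 E4].
by exists (lsubmx W), (rsubmx W).
Qed.

Lemma char_1_neq0 (x : 'cV[R]_(2 * d)) : map_mx intr N *m x = x -> x = 0.
Proof.
move=> Nx; have : ~~ eigenvalue (map_mx intr N : 'M[R]_(2 * d)) 1.
  rewrite eigenvalue_root_char hchar /root !hornerE mulf_neq0 //.
    by rewrite expf_neq0 // subr_eq0 lt_eqF.
  by rewrite expf_neq0 // subr_eq0 gt_eqF // invf_lt1.
rewrite negbK kermx_eq0 row_free_unit => u.
apply: (can_inj (mulKmx u)); rewrite mulmx0 mulmxBl mul1mx Nx subrr //.
Qed.

(** The hypotheses are what the change of phi under a translation satisfies: it is a homomorphism,
    it ignores conjugation by g_0 because its values lie in a commutative group, and it is bounded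
    on bounded sets by continuity. *)
Lemma nilgrp_hom_trivial (l : 'rV[R]_d -> 'cV[R]_d -> 'M[R]_d -> R) :
  (forall A B C A' B' C', nilgrp A B C -> nilgrp A' B' C' ->
     l (A' + A) (B' + B) (C' + B *m A' + C) = l A B C + l A' B' C') ->
  (forall A B C, nilgrp A B C -> l (alpha *: A) (alpha^-1 *: B) C = l A B C) ->
  (forall M, exists K, forall C, Dcoef C -> `|C| <= M -> `|l 0 0 C| <= K) ->
  forall A B C, nilgrp A B C -> l A B C = 0.
Proof.
move=> lM lconj lbnd.
have lC C A B C' : Dcoef C -> nilgrp A B C' -> l A B (C' + C) = l 0 0 C + l A B C'.
  move=> DC H; have := lM _ _ _ _ _ _ (nilgrp0 DC) H.
  by rewrite mul0mx !addr0.
have lD C C' : Dcoef C -> Dcoef C' -> l 0 0 (C + C') = l 0 0 C + l 0 0 C'.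
  by move=> DC DC'; rewrite lC //; [rewrite addrC|exact: nilgrp0].
have l0 : l 0 0 0 = 0.
  by have := lD _ _ Dcoef0 Dcoef0; rewrite addr0 => ?; lra.
have lN C : Dcoef C -> l 0 0 (- C) = - l 0 0 C.
  move=> DC; have := lD _ _ DC (DcoefN DC); rewrite subrr l0 => ?; lra.
have lMz C (n : int) : Dcoef C -> l 0 0 (n%:~R *: C) = n%:~R * l 0 0 C.
  move=> DC; have lMn k : l 0 0 (k%:R *: C) = k%:R * l 0 0 C.
    elim: k => [|k IH]; first by rewrite scale0r mul0r.
    rewrite -natr1 scalerDl mulrDl mul1r scale1r lD ?IH //.
    exact: (DcoefMz k).
  case: n => k; first exact: lMn.
  rewrite NegzE mulrNz scaleNr lN ?lMn ?mulNr //; exact: (DcoefMz k.+1).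
(* The products in the two orders differ by this central element, and l takes the same value on
   both. *)
have lcomm A B C A' B' C' : nilgrp A B C -> nilgrp A' B' C' ->
    Dcoef (B *m A' - B' *m A) -> l 0 0 (B *m A' - B' *m A) = 0.
  move=> H H' DE; have := lM _ _ _ _ _ _ H H'; have := lM _ _ _ _ _ _ H' H.
  have -> : C' + B *m A' + C = C + B' *m A + C' + (B *m A' - B' *m A) by mxring.
  move=> E1; rewrite (addrC A') (addrC B') lC //; last exact: nilgrpM.
  by rewrite E1 => ?; lra.
have gen_nilgrp k : nilgrp (col k a)^T (col k b) (c k).
  exists (delta_mx k 0); rewrite quad_delta subrr map_delta_mx -!colE; split=> //.
  exact: Dcoef0.
have le s t : l 0 0 (emx a b s t) = 0.
  have eE : emx a b s t = col s b *m (col t a)^T - col t b *m (col s a)^T.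
    by apply/matrixP => i j; rewrite !mxE !big_ord1 !mxE; ring.
  rewrite eE; apply: (lcomm _ _ _ _ _ _ (gen_nilgrp s) (gen_nilgrp t)).
  by rewrite -eE; exact: hDz.
have lsum (r : 'I_(2 * d) -> 'I_(2 * d) -> int) :
    Dcoef (\sum_s \sum_t (r s t)%:~R *: emx a b s t)
    /\ l 0 0 (\sum_s \sum_t (r s t)%:~R *: emx a b s t) = 0.
  pose Q X := Dcoef X /\ l 0 0 X = 0.
  have Q0 : Q 0 by split; [exact: Dcoef0|].
  have QD X Y : Q X -> Q Y -> Q (X + Y).
    by move=> [DX lX] [DY lY]; split; [exact: DcoefD|rewrite lD // lX lY addr0].
  apply: (big_ind Q Q0 QD) => s _; apply: (big_ind Q Q0 QD) => t _.
  split; first exact/DcoefMz/hDz.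
  by rewrite lMz ?le ?mulr0 //; exact: hDz.
have [U [V [aU aV bU bV UaVb]]] := eigenbasis_inv.
have lD0 C : Dcoef C -> l 0 0 C = 0.
  move=> DC.
  have [K HK] := lbnd (\sum_s \sum_t `|emx a b s t|).
  suff Hn n : `|l 0 0 C| *+ n <= K.
    apply/eqP; rewrite -normr_le0 leNgt; apply/negP => l_gt0.
    have := Hn (Num.truncn (K / `|l 0 0 C|)).+1; rewrite leNgt => /negP; apply.
    by rewrite -mulr_natl -ltr_pdivrMr // truncnS_gt.
  (* Rounding the coefficients of n C on the [emx a b s t] down to integers does
     not change l and leaves a remainder that is bounded independently of n. *)
  pose x s t := n%:R * (V *m C *m U^T) s t.
  pose r s t := Num.floor (x s t).
  have [Dr lr] := lsum r.
  (* The e^{s,t} span all real d x d matrices. With coefficients [V *m C *m U^T] the first half of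
     the sum is C because b V and a U are identities, and the second half vanishes because b U =
     0. *)
  have nC : n%:R *: C = \sum_s \sum_t x s t *: emx a b s t.
    have -> : \sum_s \sum_t x s t *: emx a b s t =
        n%:R *: (b *m (V *m C *m U^T) *m a^T - b *m (V *m C *m U^T)^T *m a^T).
      apply/matrixP => i j; rewrite /x; move: (V *m C *m U^T) => Y.
      rewrite !mxE summxE mulrBr.
      transitivity (\sum_s \sum_t (n%:R * Y s t) * (b i s * a j t - a j s * b i t)).
        by apply: eq_bigr => s _; rewrite summxE; apply: eq_bigr => t _; rewrite !mxE.
      under eq_bigr => s _ do under eq_bigr do rewrite mulrBr.
      under eq_bigr do rewrite sumrB.
      rewrite sumrB; congr (_ - _).
        rewrite exchange_big mulr_sumr /=; apply: eq_bigr => t _.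
        rewrite !mxE mulr_suml mulr_sumr; apply: eq_bigr => s _.
        by rewrite ?mxE; ring.
      rewrite mulr_sumr; apply: eq_bigr => s _.
      rewrite !mxE mulr_suml mulr_sumr; apply: eq_bigr => t _.
      by rewrite ?mxE; ring.
    rewrite !trmx_mul trmxK !mulmxA bV bU !mul0mx subr0 mul1mx -mulmxA -trmx_mul.
    by rewrite aU trmx1 mulmx1.
  have Dn : Dcoef (n%:R *: C) by exact: (DcoefMz n).
  set E := \sum_s \sum_t (r s t)%:~R *: emx a b s t in Dr lr.
  have -> : `|l 0 0 C| *+ n = `|l 0 0 (n%:R *: C - E)|.
    rewrite lD ?lN // ?lr ?oppr0 ?addr0; last exact: DcoefN.
    by rewrite (lMz _ n) // normrM normr_nat mulr_natl.
  apply: HK; first by apply: DcoefD => //; exact: DcoefN.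
  rewrite nC /E -sumrB (le_trans (ler_norm_sum _ _ _)) //; apply: ler_sum => s _.
  rewrite -sumrB (le_trans (ler_norm_sum _ _ _)) //; apply: ler_sum => t _.
  rewrite -scalerBl normrZ ler_piMl // ger0_norm ?subr_ge0 ?floor_le_tmp //.
  by rewrite lerBlDr addrC -[1]/(1%:~R) -intrD ltW // floorD1_gt.
pose x : 'cV[R]_(2 * d) := \col_k l (col k a)^T (col k b) (c k).
pose f v := l (a *m realv v)^T (b *m realv v) (quad (realv v)).
have nq v : nilgrp (a *m realv v)^T (b *m realv v) (quad (realv v)).
  by exists v; rewrite subrr; split=> //; exact: Dcoef0.
have fE A B C v : A = (a *m realv v)^T -> B = b *m realv v ->
    Dcoef (C - quad (realv v)) -> l A B C = f v.
  move=> -> -> DC; rewrite -[C](subrK (quad (realv v))) addrC lC //.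
  by rewrite lD0 ?add0r.
have fD v w : f (v + w) = f v + f w.
  rewrite -(lM _ _ _ _ _ _ (nq v) (nq w)); apply/esym/fE.
  - by rewrite map_mxD mulmxDr linearD addrC.
  - by rewrite map_mxD mulmxDr addrC.
  - have := quadD v w; congr Dcoef; mxring.
have fx v : f v = \sum_k (v k 0)%:~R * x k 0.
  have f0 : f 0 = 0.
    by have := fD 0 0; rewrite addr0 => ?; lra.
  pose S v := f v = \sum_k (v k 0)%:~R * x k 0.
  apply: (@int_cV_ind _ S); rewrite /S.
  - by rewrite f0 big1 // => k _; rewrite mxE mul0r.
  - move=> v1 v2; rewrite fD => -> ->; rewrite -big_split /=.
    by apply: eq_bigr => k _; rewrite !mxE rmorphD mulrDl.
  - move=> v1 Hv; have := fD v1 (- v1); rewrite subrr f0 Hv => E.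
    have -> : f (- v1) = - \sum_k (v1 k 0)%:~R * x k 0 by lra.
    rewrite -sumrN.
    by apply: eq_bigr => k _; rewrite !mxE rmorphN mulNr.
  - move=> k; rewrite (bigD1 k) //= !mxE !eqxx mul1r big1 ?addr0; last first.
      by move=> i /negPf ik; rewrite !mxE ik mul0r.
    by rewrite /f quad_delta map_delta_mx -!colE.
(* Invariance of f under N^T, applied to the k-th unit vector, is row k of the equation N x = x. *)
have x0 : x = 0.
  apply: char_1_neq0; apply/matrixP => k j; rewrite ord1 mxE.
  have fN v : f (N^T *m v) = f v.
    rewrite -[RHS]/(l _ _ _) -lconj //; apply/esym/fE.
    - by rewrite map_mxM mulmxA eigenvec_a -scalemxAl linearZ.
    - by rewrite map_mxM mulmxA eigenvec_b -scalemxAl.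
    - by have := DcoefN (quad_conj v); rewrite opprB.
  have := fN (delta_mx k 0); rewrite !fx => E.
  have xk : x k 0 = \sum_i ((delta_mx k 0 : 'cV[int]_(2 * d)) i 0)%:~R * x i 0.
    rewrite (bigD1 k) //= [delta_mx _ _ _ _]mxE !eqxx mul1r big1 ?addr0 //.
    by move=> i /negPf ik; rewrite [delta_mx _ _ _ _]mxE ik mul0r.
  rewrite [RHS]xk -E; apply: eq_bigr => s _.
  by congr (_ * _); rewrite -colE !mxE.
move=> A B C [v [EA EB DC]]; rewrite (fE _ _ _ v) // fx big1 // => k _.
by rewrite x0 mxE mulr0.
Qed.

Lemma Dcoef_discrete : exists2 e, 0 < e & forall C, Dcoef C -> `|C| < e -> C = 0.
Proof.
have [_ _ [W [oW W1 DW]] _] := hD.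
have /nbhs_ballP[e e0 eW] : nbhs (1%:M : 'M[R]_(d + (1 + d))) W.
  exact: open_nbhs_nbhs.
exists e => // C DC Ce.
have /DW : (D `&` W) (Gmx 1 0 0 C).
  split=> //; apply: eW; rewrite -Gmx1; rewrite -ball_normE /=.
  by apply: le_lt_trans Ce; exact: Gmx_dist1.
by rewrite -Gmx1 => /Gmx_inj[].
Qed.

(** Small A and B force the integral exponent vector to be 0, and then C lies in D. The bound on C
    is asked for last, since in [locally_free] it becomes available only after B = 0 is known. *)
Lemma nilgrp_discrete : exists2 e, 0 < e &
  forall A B C, nilgrp A B C -> `|A| < e -> `|B| < e ->
  [/\ A = 0, B = 0 & `|C| < e -> C = 0].
Proof.
have [e e0 De] := Dcoef_discrete.
have [U [V [aU aV bU bV UaVb]]] := eigenbasis_inv.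
pose K : R := d%:R * (`|U| + `|V|) + 1.
have K0 : 0 < K by rewrite ltr_wpDl // mulr_ge0 // addr_ge0.
exists (Num.min e K^-1); first by rewrite lt_min e0 invr_gt0.
move=> A B C [v [EA EB DC]]; rewrite !lt_min => /andP[_ Ae] /andP[_ Be].
have rv1 : `|realv v| < 1.
  rewrite -[realv v]mul1mx -UaVb mulmxDl -!mulmxA -EB.
  have -> : a *m realv v = A^T by rewrite EA trmxK.
  rewrite (le_lt_trans (ler_normD _ _)) //.
  have h1 := mulmx_norm_le U A^T; have h2 := mulmx_norm_le V B.
  rewrite trmx_norm in h1.
  apply: (@le_lt_trans _ _ (d%:R * (`|U| * K^-1) + d%:R * (`|V| * K^-1))).
    apply: lerD; [apply: le_trans h1 _|apply: le_trans h2 _];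
      by rewrite ler_wpM2l // ler_wpM2l // ltW.
  by rewrite !mulrA -!mulrDl -mulrDr ltr_pdivrMr // mul1r ltrDl.
have v0 : v = 0.
  apply/matrixP => k j; rewrite ord1 mxE; apply/eqP; rewrite -absz_eq0.
  have := le_lt_trans (ler_mx_norm (realv v) k 0) rv1.
  rewrite mxE -intr_norm -[1]/(1%:~R) ltr_int; lia.
have r0 : realv 0 = 0 by apply/matrixP => i j; rewrite !mxE.
rewrite EA EB v0 r0 !mulmx0 trmx0; split=> // /andP[Ce _]; apply: De => //.
by move: DC; rewrite v0 r0 quad0 subr0.
Qed.

(** The triple to be bounded is that of M(1, A', B', C') M(1, A, B, C). The real exponent vector of
    (A, B) is rounded to an integral one, which leaves fractional parts; afterwards the
    cocompactness of D corrects the central part. *)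
Lemma nilgrp_cocompact : exists M, forall A B C, exists A' B' C',
  [/\ nilgrp A' B' C', `|A + A'| <= M, `|B + B'| <= M &
   `|C + B' *m A + C'| <= M].
Proof.
have [U [V [aU aV bU bV UaVb]]] := eigenbasis_inv.
have [_ DZ _ [K [cK KZ DK]]] := hD.
have [M [_ KM]] := compact_bounded cK.
pose M' := (`|M| + 1 + (2 * d)%:R * `|a| + (2 * d)%:R * `|b|).
exists M' => A B C.
pose x := U *m A^T + V *m B.
have ax : a *m x = A^T.
  by rewrite mulmxDr !mulmxA aU aV mul0mx addr0 mul1mx.
have bx : b *m x = B.
  by rewrite mulmxDr !mulmxA bU bV mul0mx add0r mul1mx.
pose v : 'cV[int]_(2 * d) := \col_k - Num.floor (x k 0).
have xv : `|x + realv v| <= 1.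
  apply: mx_norm_le => // k j; rewrite ord1.
  have -> : (x + realv v) k 0 = x k 0 - (Num.floor (x k 0))%:~R.
    by rewrite mxE; congr (_ + _); rewrite mxE [v _ _]mxE rmorphN.
  have /andP[] := floor_itv (x k 0); rewrite intrD ler_norml => h1 h2.
  by apply/andP; split; lra.
have [l [k [Dl Kk Elk]]] := DK (Gmx 1 0 0 (C + (b *m realv v) *m A + quad (realv v)))
  (imageT _ _).
have [delta _ El] := DZ _ Dl; have [kappa _ Ek] := KZ _ Kk.
move: Elk; rewrite -El -Ek Gmx_mul mul0mx !addr0 => /Gmx_inj[_ _ _ EC].
exists (a *m realv v)^T, (b *m realv v), (quad (realv v) - delta).
split.
- exists v; split=> //; rewrite addrAC subrr add0r.
  by apply: DcoefN; rewrite /Dcoef El.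
- rewrite -[A]trmxK -linearD /= trmx_norm -ax -mulmxDr.
  rewrite (le_trans (mulmx_norm_le _ _)) // mulrA.
  rewrite (le_trans (ler_wpM2l _ xv)) ?mulr_ge0 // mulr1 /M'.
  have := normr_ge0 M; have : 0 <= (2 * d)%:R * `|b| by rewrite mulr_ge0.
  by lra.
- rewrite -{1}bx -mulmxDr.
  rewrite (le_trans (mulmx_norm_le _ _)) // mulrA.
  rewrite (le_trans (ler_wpM2l _ xv)) ?mulr_ge0 // mulr1 /M'.
  have := normr_ge0 M; have : 0 <= (2 * d)%:R * `|a| by rewrite mulr_ge0.
  by lra.
- rewrite addrA EC addrK (le_trans (Gmx_coef_norm 1 0 0 kappa)) // Ek.
  rewrite (le_trans (KM (`|M| + 1) _ _ Kk)) ?(le_lt_trans (ler_norm M)) ?ltrDl //.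
  by rewrite /M' -addrA lerDl addr_ge0 // mulr_ge0.
Qed.

End Lattice.

(** * Potentials of closed forms and averages of divergences *)

Section LineDerivative.
Variables (R : realType) (E : normedModType R).
Implicit Types (f : E -> R) (u v x y : E).

Lemma line_derive f y v (t : R) : differentiable f (y + t *: v) ->
  is_derive t 1 (fun s : R => f (y + s *: v)) ('D_v f (y + t *: v)).
Proof.
move=> df; pose g (s : R) : E := y + s *: v.
have dg : is_diff t g (0 + ( *:%R^~ v)).
  by apply: is_diffD; exact: is_diff_scalel.
have [dg1 dg2] := dg.
have dfg : differentiable (f \o g) t by exact: differentiable_comp.
apply: DeriveDef; first exact: diff_derivable.
rewrite -/(f \o g) deriveE // diff_comp // dg2.
by rewrite /= fctE add0r scale1r deriveE.
Qed.

Lemma line_growth_rate f y v (t : R) :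
  (fun h => h^-1 *: (((fun s : R => f (y + s *: v)) \o shift t) (h *: 1)
                     - f (y + t *: v))) =
  (fun h => h^-1 *: ((f \o shift (y + t *: v)) (h *: v) - f (y + t *: v))).
Proof.
apply/funext => h /=; congr (_ *: (f _ - _)).
by rewrite [_%:A]mulr1 scalerDl addrCA.
Qed.

(** Allows the mean value theorem and the rules of one-variable calculus to be used for directional
    derivatives. *)
Lemma is_derive_lineP f y v (t d : R) :
  is_derive t 1 (fun s : R => f (y + s *: v)) d <-> is_derive (y + t *: v) v f d.
Proof.
by split=> -[dl dd]; apply: DeriveDef;
  move: dl dd; rewrite /derivable /derive line_growth_rate.
Qed.

End LineDerivative.

Lemma compact_continuous_bounded (R : realType) (T : topologicalType)
    (K : set T) (f : T -> R) :
  compact K -> (forall x, K x -> {for x, continuous f}) ->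
  exists2 M, 0 <= M & forall x, K x -> `|f x| <= M.
Proof.
move=> cK cf; have : compact (f @` K).
  apply: continuous_compact => //; apply: continuous_in_subspaceT => x.
  by rewrite inE; exact: cf.
move=> /compact_bounded[M [_ HM]]; exists (`|M| + 1); first by rewrite addr_ge0.
move=> x Kx; apply: (HM (`|M| + 1)); last by exists x.
by rewrite (le_lt_trans (ler_norm M)) // ltrDl.
Qed.

Section Poincare.
Variables (R : realType) (E : normedModType R).
Variables (V : set E) (p0 : E) (th : E -> E -> R).
Hypothesis oV : open V.
Hypothesis starV : forall x (t : R), V x -> 0 <= t <= 1 -> V (p0 + t *: (x - p0)).
Hypothesis lin : forall x (k : R) u v, th x (k *: u + v) = k * th x u + th x v.
Hypothesis dth : forall u x, V x -> differentiable (th^~ u) x.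
Hypothesis cth : forall u v x, V x -> {for x, continuous ('D_v (th^~ u))}.
Hypothesis closed_th : forall u v x, V x -> 'D_u (th^~ v) x = 'D_v (th^~ u) x.

Let mu := @lebesgue_measure R.

Definition radial_primitive (z : E) : R :=
  \int[mu]_(t in `[0, 1]) th (p0 + t *: (z - p0)) (z - p0).

(** With w = z - p0, differentiation under the integral gives the integrand t D_u th(w) + th(u) at
    p0 + t w. Closedness replaces D_u th(w) by D_w th(u), and the integrand becomes the derivative
    in t of t th(p0 + t w)(u), whose value at t = 1 is th(z)(u). *)
Lemma radial_primitive_derive z u :
  V z -> is_derive z u radial_primitive (th z u).
Proof.
move=> Vz; rewrite -[X in is_derive X]addr0 -[X in _ + X](scale0r u).
apply/is_derive_lineP.
set w := z - p0.
pose P (x t : R) := p0 + t *: (w + x *: u).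
pose F (x t : R) := th (P x t) (w + x *: u).
have [rho rho0 Vrho] : exists2 rho : R, 0 < rho &
    forall x : R, x \in `[- rho, rho] -> V (z + x *: u).
  have cl : {for (0 : R), continuous (fun x : R => z + x *: u)}.
    by apply: cvgD; [exact: cvg_cst|apply: cvgZr_tmp; exact: cvg_id].
  have /cl/nbhs_ballP[e e0 eV] : nbhs (z + 0 *: u) V.
    by rewrite scale0r addr0; exact: open_nbhs_nbhs.
  exists (e / 2) => [|x]; first by rewrite divr_gt0.
  rewrite in_itv /= => /andP[x1 x2]; apply: eV; rewrite /ball /= sub0r normrN.
  by rewrite ltr_norml; have {}e0 : 0 < e := e0; apply/andP; split; lra.
have VP x t : x \in `[- rho, rho] -> 0 <= t <= 1 -> V (P x t).
  move=> xr t1; have := starV (Vrho _ xr) t1.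
  by rewrite /P /w addrAC.
have phiE x : radial_primitive (z + x *: u) = \int[mu]_(t in `[0, 1]) F x t.
  by rewrite /radial_primitive /F /P /w addrAC.
have FE x t : F x t = th (P x t) w + x * th (P x t) u.
  by rewrite /F addrC lin addrC.
pose dF x t := t * 'D_u (th^~ w) (P x t)
               + (th (P x t) u + x * (t * 'D_u (th^~ u) (P x t))).
have dP v x t : x \in `[- rho, rho] -> 0 <= t <= 1 ->
    is_derive x 1 (fun s : R => th (P s t) v) (t * 'D_u (th^~ v) (P x t)).
  move=> xr t1; have PE s : P s t = (p0 + t *: w) + s *: (t *: u).
    by rewrite /P scalerDr addrA !scalerA mulrC.
  have VPx := VP _ _ xr t1.
  have := @line_derive R E (th^~ v) (p0 + t *: w) (t *: u) x.
  rewrite -PE => /(_ (dth _ VPx)); rewrite deriveE; last exact: dth.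
  rewrite linearZ -deriveE; last exact: dth.
  by under eq_fun do rewrite -PE.
have dFd x t : x \in `[- rho, rho] -> 0 <= t <= 1 ->
    is_derive x 1 (F ^~ t) (dF x t).
  move=> xr t1; rewrite (_ : F^~ t = (fun s => th (P s t) w) +
      (id * (fun s => th (P s t) u))); last first.
    by apply/funext => s; rewrite /= FE.
  have h1 := dP w _ _ xr t1; have h2 := dP u _ _ xr t1.
  by apply: is_derive_eq; rewrite /dF /GRing.scale /= mulr1; ring.
have x0 : 0 \in `[- rho, rho] by rewrite in_itv /= oppr_le0 ltW.
have P2c (xt : R * R) : {for xt, continuous (fun xt : R * R => P xt.1 xt.2)}.
  apply: cvgD; first exact: cvg_cst.
  apply: cvgZ; first exact: cvg_snd.
  apply: cvgD; first exact: cvg_cst.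
  by apply: cvgZr_tmp; exact: cvg_fst.
(* Compactness of this parameter rectangle yields the constant that dominates the derivative of the
   integrand. *)
pose K := `[- rho, rho]%classic `*` `[(0 : R), 1]%classic.
have cK : compact K by apply: compact_setX; exact: segment_compact.
have bnd (f : E -> R) : (forall y, V y -> {for y, continuous f}) ->
    exists2 M, 0 <= M & forall x t, x \in `[- rho, rho] -> 0 <= t <= 1 ->
      `|f (P x t)| <= M.
  move=> cf; have cfP xt : K xt -> {for xt, continuous (fun xt => f (P xt.1 xt.2))}.
    case: xt => x t [/= xr t1]; apply: (continuous_comp (P2c (x, t))); apply: cf.
    by apply: VP => //; move: t1; rewrite in_itv.
  have [M M0 HM] := compact_continuous_bounded cK cfP.
  by exists M => // x t xr t1; apply: (HM (x, t)); split => //=; rewrite in_itv.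
have cth0 v y : V y -> {for y, continuous (th^~ v)}.
  by move=> Vy; apply: differentiable_continuous; exact: dth.
have [M1 M10 HM1] := bnd _ (cth0 u).
have [M2 M20 HM2] := bnd _ (@cth w u).
have [M3 M30 HM3] := bnd _ (@cth u u).
pose M := M2 + (M1 + rho * M3).
have dF_bnd x t : x \in `[- rho, rho] -> 0 <= t <= 1 -> `|dF x t| <= M.
  move=> xr t1; have /andP[t0 t1'] := t1.
  have xrho : `|x| <= rho by move: xr; rewrite in_itv /= ler_norml.
  rewrite (le_trans (ler_normD _ _)) // lerD //.
    by rewrite normrM ger0_norm // (le_trans _ (HM2 _ _ xr t1)) // ler_piMl.
  rewrite (le_trans (ler_normD _ _)) // lerD //; first exact: HM1.
  rewrite !normrM ler_pM ?mulr_ge0 // ger0_norm //.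
  by rewrite (le_trans _ (HM3 _ _ xr t1)) // ler_piMl.
have Pc x t : {for t, continuous (P x)}.
  by apply: cvgD; [exact: cvg_cst|apply: cvgZr_tmp; exact: cvg_id].
have Fc v x : x \in `[- rho, rho] ->
    {within `[(0 : R), 1], continuous (fun t => th (P x t) v)}.
  move=> xr; apply: continuous_in_subspaceT => t; rewrite inE /= in_itv /= => t1.
  have cv := cth0 v _ (VP _ _ xr t1).
  exact: (@continuous_comp _ _ _ (P x) (th^~ v) t (Pc x t) cv).
have intF x : `]- rho, rho[%classic x ->
    mu.-integrable `[(0 : R), 1] (EFin \o F x).
  move=> /subset_itv_oo_cc xr; apply: continuous_compact_integrable.
    exact: segment_compact.
  exact: Fc.
have d1F x t : `]- rho, rho[%classic x -> 0 <= t <= 1 -> partial1of2 F x t = dF x t.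
  move=> /subset_itv_oo_cc xr t1; rewrite partial1of2E.
  by have [_ ->] := dFd _ _ xr t1.
have I0 : `]- rho, rho[%classic 0 by rewrite /= in_itv /= rho0 oppr_lt0 rho0.
have dIF : is_derive (0 : R) 1 (fun x => \int[mu]_(t in `[0, 1]) F x t)
    (\int[mu]_(t in `[0, 1]) partial1of2 F 0 t).
  have mI : measurable (`[0, 1] : set (measurableTypeR R)) by exact: measurable_itv.
  have dF1 x t : `]- rho, rho[%classic x -> `[0, 1]%classic t -> derivable (F^~ t) x 1.
    by rewrite /= in_itv /= => /subset_itv_oo_cc xr; rewrite in_itv => /(dFd _ _ xr)[].
  have intM : mu.-integrable `[0, 1] (EFin \o cst M).
    apply: continuous_compact_integrable; first exact: segment_compact.
    by apply: continuous_subspaceT => ?; exact: cvg_cst.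
  have ubM x t : `]- rho, rho[%classic x -> `[0, 1]%classic t ->
      `|partial1of2 F x t| <= cst M t.
    move=> xr; rewrite /= in_itv /= => t1; rewrite d1F //.
    by apply: dF_bnd => //; exact: subset_itv_oo_cc.
  have M0 : forall t : R, 0 <= cst M t by move=> t; rewrite !addr_ge0 // mulr_ge0 // ltW.
  apply: DeriveDef.
    exact: (derivable_under_integral mI I0 intF dF1 M0 intM ubM).
  rewrite -derive1E.
  exact: (differentiation_under_integral mI I0 intF dF1 M0 intM ubM).
rewrite (_ : (fun x => _) = fun x => \int[mu]_(t in `[0, 1]) F x t); last first.
  by apply/funext => x; exact: phiE.
apply: (is_derive_eq dIF).
have P0 (t : R) : P 0 t = p0 + t *: w by rewrite /P scale0r addr0.
pose A (t : R) := t * th (P 0 t) u.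
have dA (t : R) : 0 <= t <= 1 -> is_derive t 1 A (dF 0 t).
  move=> t1; have VPt := VP _ _ x0 t1.
  have := @line_derive R E (th^~ u) p0 w t; rewrite -P0 => /(_ (dth _ VPt)).
  under eq_fun do rewrite -P0.
  move=> h1; rewrite (_ : A = id * (fun t => th (P 0 t) u)) //.
  apply: is_derive_eq; rewrite /dF mul0r addr0 (closed_th u w VPt) /GRing.scale /=.
  by rewrite mulr1; ring.
have cdF : {within `[(0 : R), 1], continuous (dF 0)}.
  apply: continuous_in_subspaceT => t; rewrite inE /= in_itv /= => t1.
  have cD v := @continuous_comp _ _ _ (P 0) _ t (Pc 0 t) (@cth v u _ (VP _ _ x0 t1)).
  have c0 := @continuous_comp _ _ _ (P 0) _ t (Pc 0 t) (cth0 u _ (VP _ _ x0 t1)).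
  apply: cvgD; first by apply: cvgM; [exact: cvg_id|exact: cD].
  apply: cvgD; first exact: c0.
  by apply: cvgM; [exact: cvg_cst|apply: cvgM; [exact: cvg_id|exact: cD]].
have cA : {within `[(0 : R), 1], continuous A}.
  apply: continuous_in_subspaceT => t; rewrite inE /= in_itv /= => /dA[d1 _].
  exact/differentiable_continuous/derivable1_diffP.
have dA01 : derivable_oo_LRcontinuous A 0 1.
  have [_ l r] := (continuous_within_itvP _ ltr01).1 cA; split => //.
  by move=> t /subset_itv_oo_cc; rewrite in_itv /= => /dA[].
have A'E : {in `]0, 1[, derive1 A =1 dF 0}.
  by move=> t /subset_itv_oo_cc; rewrite in_itv /= derive1E => /dA[].
have d1E : {in `[0, 1]%classic, partial1of2 F 0 =1 dF 0}.
  by move=> t; rewrite inE /= in_itv /= => t1; exact: d1F.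
rewrite (eq_Rintegral mu d1E).
rewrite /Rintegral (continuous_FTC2 ltr01 cdF dA01 A'E) /= /A mul0r subr0 mul1r.
by rewrite P0 scale1r /w addrC subrK.
Qed.

End Poincare.

Section Divergence.
Variable R : realType.

(** Continuity is meant in the ambient space, so y may lie outside K. *)
Lemma compact_uniformly_continuous (E : normedModType R) (K : set E) (f : E -> R) :
  compact K -> (forall x, K x -> {for x, continuous f}) ->
  forall eta, 0 < eta -> exists2 delta, 0 < delta &
    forall x y, K x -> `|x - y| < delta -> `|f x - f y| < eta.
Proof.
move=> /compact_near_coveringP cK cf eta eta0.
have : \forall r \near (0 : R)^'+,
    K `<=` (fun x => forall y, `|x - y| < r -> `|f x - f y| < eta).
  apply: cK => x /cf /cvgrPdist_lt /(_ (eta / 2)).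
  have e20 : 0 < eta / 2 by rewrite divr_gt0.
  move=> /(_ e20) /nbhs_ballP[e /= e0 xe].
  exists (ball x (e / 2), [set r | r < e / 2]).
    split; first by apply: nbhsx_ballx; rewrite divr_gt0.
    by apply: nbhs_right_lt; rewrite divr_gt0.
  move=> [x' r] [/= xx' re] y x'y.
  have {}xx' : `|x - x'| < e / 2 by move: xx'; rewrite -ball_normE.
  have h1 := xe x'; have h2 := xe y; rewrite -ball_normE /= in h1 h2.
  have {}h1 : `|f x - f x'| < eta / 2 by apply: h1; lra.
  have {}h2 : `|f x - f y| < eta / 2.
    apply: h2; have := ler_normD (x - x') (x' - y); rewrite addrA subrK => ?; lra.
  have := ler_normB (f x - f y) (f x - f x').
  by rewrite opprB addrC addrA subrK => ?; lra.
move=> H; near (0 : R)^'+ => r.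
exists r => [|x y Kx]; first by near: r; exact: nbhs_right_gt.
by apply: (near H r).
Unshelve. all: by end_near. Qed.

(** By the mean value theorem each term is, up to eta, a difference quotient of f with step L / n.
    The quotients telescope, and only the two end values of f remain. *)
Lemma sum_grid (f g : R -> R) (L M eta : R) (n : nat) : (0 < n)%N -> 0 < L ->
  (forall t, 0 <= t <= L -> is_derive t 1 f (g t)) ->
  (forall t, 0 <= t <= L -> `|f t| <= M) ->
  (forall t s, 0 <= t <= L -> 0 <= s <= L -> `|t - s| <= L / n%:R ->
     `|g t - g s| <= eta) ->
  \sum_(k < n) g (k%:R * (L / n%:R)) <= n%:R * (2 * M / L + eta).
Proof.
move=> n0 L0 df fM gu; set h := L / n%:R.
have h0 : 0 < h by rewrite divr_gt0 // ltr0n.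
have hn : n%:R * h = L by rewrite mulrC divfK // pnatr_eq0 -lt0n.
have in_box k : (k <= n)%N -> 0 <= k%:R * h <= L.
  by move=> kn; rewrite mulr_ge0 ?(ltW h0) //= -hn ler_wpM2r ?ler_nat // ltW.
have step (k : 'I_n) : g (k%:R * h) <= (f (k.+1%:R * h) - f (k%:R * h)) / h + eta.
  have k1 := in_box _ (ltn_ord k); have k0 := in_box _ (ltnW (ltn_ord k)).
  have lekk : k%:R * h < k.+1%:R * h by rewrite ltr_pM2r // ltr_nat.
  have sub t : t \in `[k%:R * h, k.+1%:R * h] -> 0 <= t <= L.
    rewrite in_itv /= => /andP[t1 t2]; apply/andP; split.
      by apply: le_trans t1; case/andP: k0.
    by apply: (le_trans t2); case/andP: k1.
  have dfk t : t \in `]k%:R * h, k.+1%:R * h[ -> is_derive t 1 f (g t).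
    by move=> /subset_itv_oo_cc/sub/df.
  have cfk : {within `[k%:R * h, k.+1%:R * h], continuous f}.
    apply: continuous_in_subspaceT => t; rewrite inE => /sub/df[d1 _].
    exact/differentiable_continuous/derivable1_diffP.
  have [s sk ->] := MVT_segment (ltW lekk) dfk cfk.
  have -> : k.+1%:R * h - k%:R * h = h by rewrite -natr1 mulrDl mul1r addrC addKr.
  rewrite mulfK ?gt_eqF // -lerBlDl (le_trans (ler_norm _)) //.
  apply: gu => //; first exact: sub.
  move: sk; rewrite in_itv /= -natr1 mulrDl mul1r ler_norml -/h => /andP[? ?].
  by apply/andP; split; lra.
apply: (le_trans (ler_sum _ (fun k _ => step k))).
rewrite big_split /= -mulr_suml sumr_const card_ord.
rewrite -(big_mkord xpredT (fun k => f (k.+1%:R * h) - f (k%:R * h))).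
rewrite telescope_sumr // mul0r hn mulrDr -[X in _ + X]mulr_natl lerD2r.
have -> : n%:R * (2 * M / L) = 2 * M / h.
  by rewrite /h invf_div; field; rewrite ?gt_eqF //= pnatr_eq0 -lt0n n0.
rewrite ler_pM2r ?invr_gt0 //.
have := fM L; have := fM 0; rewrite !lexx (ltW L0) !ler_norml.
by move=> /(_ isT)/andP[? ?] /(_ isT)/andP[? ?]; lra.
Qed.

(** A cyclic rotation of the four sums, to bring the direction in which the sum telescopes into the
    innermost place. *)
Lemma sum_grid4 (F : nat -> nat -> nat -> nat -> R) (n : nat) :
  \sum_(i < n) \sum_(j < n) \sum_(k < n) \sum_(l < n) F i j k l =
  \sum_(j < n) \sum_(k < n) \sum_(l < n) \sum_(i < n) F i j k l.
Proof.
rewrite exchange_big; apply: eq_bigr => j _.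
rewrite exchange_big; apply: eq_bigr => k _.
by rewrite exchange_big.
Qed.

Lemma ler_sum_const (n : nat) (F : 'I_n -> R) (C : R) :
  (forall i, F i <= C) -> \sum_(i < n) F i <= n%:R * C.
Proof.
move=> FC; have -> : n%:R * C = \sum_(i < n) C.
  by rewrite sumr_const card_ord mulr_natl.
by apply: ler_sum.
Qed.

Lemma ler_const_sum (n : nat) (F : 'I_n -> R) (C : R) :
  (forall i, C <= F i) -> n%:R * C <= \sum_(i < n) F i.
Proof.
move=> FC; rewrite -lerN2 -mulrN -sumrN.
by apply: ler_sum_const => i; rewrite lerN2.
Qed.

Lemma sum_grid4_le (F : nat -> nat -> nat -> nat -> R) (n : nat) (C : R) :
  (forall i j k, (i < n)%N -> (j < n)%N -> (k < n)%N ->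
     \sum_(l < n) F i j k l <= n%:R * C) ->
  \sum_(i < n) \sum_(j < n) \sum_(k < n) \sum_(l < n) F i j k l <=
  n%:R ^+ 4 * C.
Proof.
move=> FC; have -> : n%:R ^+ 4 * C = n%:R * (n%:R * (n%:R * (n%:R * C))) by ring.
by do 3 (apply: ler_sum_const => ?); exact: FC.
Qed.

Lemma sum_grid_line (E : normedModType R) (X Y : E -> R) (p e : E)
    (L M eta delta : R) (n : nat) : (0 < n)%N -> 0 < L -> L / n%:R * `|e| < delta ->
  (forall t, 0 <= t <= L -> is_derive (p + t *: e) e X (Y (p + t *: e))) ->
  (forall t, 0 <= t <= L -> `|X (p + t *: e)| <= M) ->
  (forall t s, 0 <= t <= L -> `|(p + t *: e) - (p + s *: e)| < delta ->
     `|Y (p + t *: e) - Y (p + s *: e)| < eta) ->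
  \sum_(k < n) Y (p + (k%:R * (L / n%:R)) *: e) <= n%:R * (2 * M / L + eta).
Proof.
move=> n0 L0 small dX XM Yu.
apply: (@sum_grid (fun t => X (p + t *: e)) (fun t => Y (p + t *: e))) => //.
  by move=> t /dX dt; apply/is_derive_lineP.
move=> t s bt _ ts; apply/ltW/Yu => //.
rewrite opprD addrACA addrN add0r -scalerBl normrZ.
by apply: le_lt_trans small; rewrite ler_wpM2r.
Qed.

Variables (E : normedModType R) (p0 e1 e2 e3 e4 : E).

Definition boxpt (x1 x2 x3 x4 : R) : E :=
  p0 + x1 *: e1 + x2 *: e2 + x3 *: e3 + x4 *: e4.

Lemma boxpt_line1 x1 x2 x3 x4 : boxpt x1 x2 x3 x4 = boxpt 0 x2 x3 x4 + x1 *: e1.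
Proof. by rewrite /boxpt scale0r addr0 -!addrA; congr (_ + _); rewrite addrC !addrA. Qed.

Lemma boxpt_line2 x1 x2 x3 x4 : boxpt x1 x2 x3 x4 = boxpt x1 0 x3 x4 + x2 *: e2.
Proof. by rewrite /boxpt scale0r addr0 -!addrA; do 2!congr (_ + _); rewrite addrC addrA. Qed.

Lemma boxpt_line3 x1 x2 x3 x4 : boxpt x1 x2 x3 x4 = boxpt x1 x2 0 x4 + x3 *: e3.
Proof. by rewrite /boxpt scale0r addr0 addrAC. Qed.

Lemma boxpt_line4 x1 x2 x3 x4 : boxpt x1 x2 x3 x4 = boxpt x1 x2 x3 0 + x4 *: e4.
Proof. by rewrite /boxpt scale0r addr0. Qed.

Variables (L1 L2 L3 L4 M1 M2 M3 M4 eps : R).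
Hypotheses (L1_gt0 : 0 < L1) (L2_gt0 : 0 < L2) (L3_gt0 : 0 < L3) (L4_gt0 : 0 < L4).

Definition box : set E := [set p | exists x1 x2 x3 x4,
  [/\ 0 <= x1 <= L1, 0 <= x2 <= L2, 0 <= x3 <= L3, 0 <= x4 <= L4
    & p = boxpt x1 x2 x3 x4]].

Variables (X1 X2 X3 X4 Y1 Y2 Y3 Y4 : E -> R).

(** The divergence theorem for averages, with a grid of n^4 points instead of an integral. Opposite
    faces orthogonal to the i-th edge contribute at most 2 M_i / L_i; the error of the grid tends to
    0 by uniform continuity. *)
Lemma divergence_box (K : set E) : compact K -> box `<=` K ->
  (forall p, K p -> {for p, continuous Y1}) ->
  (forall p, K p -> {for p, continuous Y2}) ->
  (forall p, K p -> {for p, continuous Y3}) ->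
  (forall p, K p -> {for p, continuous Y4}) ->
  (forall p, box p -> [/\ is_derive p e1 X1 (Y1 p), is_derive p e2 X2 (Y2 p),
     is_derive p e3 X3 (Y3 p) & is_derive p e4 X4 (Y4 p)]) ->
  (forall p, box p -> [/\ `|X1 p| <= M1, `|X2 p| <= M2, `|X3 p| <= M3
     & `|X4 p| <= M4]) ->
  (forall p, box p -> eps <= Y1 p + Y2 p + Y3 p + Y4 p) ->
  eps <= 2 * M1 / L1 + 2 * M2 / L2 + 2 * M3 / L3 + 2 * M4 / L4.
Proof.
move=> cK bK cY1 cY2 cY3 cY4 dX XM Yeps.
apply/ler_addgt0Pr => eta0 eta0_gt0; pose eta := eta0 / 4.
have eta_gt0 : 0 < eta by rewrite divr_gt0.
have [r1 r1_gt0 U1] := compact_uniformly_continuous cK cY1 eta_gt0.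
have [r2 r2_gt0 U2] := compact_uniformly_continuous cK cY2 eta_gt0.
have [r3 r3_gt0 U3] := compact_uniformly_continuous cK cY3 eta_gt0.
have [r4 r4_gt0 U4] := compact_uniformly_continuous cK cY4 eta_gt0.
have [n n0 [S1 S2 S3 S4]] : exists2 n : nat, (0 < n)%N &
    [/\ L1 / n%:R * `|e1| < r1, L2 / n%:R * `|e2| < r2,
      L3 / n%:R * `|e3| < r3 & L4 / n%:R * `|e4| < r4].
  (* All four ratios are nonnegative, so an n above their sum exceeds each of them. *)
  pose T := \sum_(q <- [:: L1 * `|e1| / r1; L2 * `|e2| / r2; L3 * `|e3| / r3;
    L4 * `|e4| / r4]) q.
  have Tn : T < (Num.truncn T).+1%:R by exact: truncnS_gt.
  have T0 L (e : E) r : 0 < L -> 0 < r -> 0 <= L * `|e| / r.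
    by move=> ? ?; rewrite divr_ge0 ?mulr_ge0 // ltW.
  have T1 := T0 _ e1 _ L1_gt0 r1_gt0; have T2 := T0 _ e2 _ L2_gt0 r2_gt0.
  have T3 := T0 _ e3 _ L3_gt0 r3_gt0; have T4 := T0 _ e4 _ L4_gt0 r4_gt0.
  exists (Num.truncn T).+1 => //.
  move: Tn; rewrite /T !big_cons big_nil addr0.
  set N := _.+1%:R => Tn.
  have N0 : 0 < N by rewrite ltr0n.
  have small L (e : E) r : 0 < r -> L * `|e| / r < N -> L / N * `|e| < r.
    by move=> r0; rewrite ltr_pdivrMr // => ?; rewrite mulrAC ltr_pdivrMr // [X in _ < X]mulrC.
  by split; apply: small => //; lra.
pose h1 := L1 / n%:R; pose h2 := L2 / n%:R; pose h3 := L3 / n%:R; pose h4 := L4 / n%:R.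
have in_box (L : R) k : 0 < L -> (k < n)%N -> 0 <= k%:R * (L / n%:R) <= L.
  move=> L0 kn; have n0' : 0 < n%:R :> R by rewrite ltr0n.
  apply/andP; split; first by rewrite mulr_ge0 ?divr_ge0 ?(ltW L0).
  by rewrite mulrA ler_pdivrMr // mulrC ler_wpM2l ?(ltW L0) // ler_nat ltnW.
pose Y p := Y1 p + Y2 p + Y3 p + Y4 p.
pose F Z (i j k l : nat) : R := Z (boxpt (i%:R * h1) (j%:R * h2) (k%:R * h3) (l%:R * h4)).
pose S Z := \sum_(i < n) \sum_(j < n) \sum_(k < n) \sum_(l < n) F Z i j k l.
have SY : S Y = S Y1 + S Y2 + S Y3 + S Y4.
  rewrite /S -!big_split; do 4 (apply: eq_bigr => ? _; rewrite -?big_split).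
  by [].
have lowY : n%:R ^+ 4 * eps <= S Y.
  have -> : n%:R ^+ 4 * eps = n%:R * (n%:R * (n%:R * (n%:R * eps))) by ring.
  do 4 (apply: ler_const_sum => ?).
  by apply: Yeps; do 4 eexists; split; [exact: in_box..|].
have up1 : S Y1 <= n%:R ^+ 4 * (2 * M1 / L1 + eta).
  rewrite /S sum_grid4.
  apply: (@sum_grid4_le (fun x2 x3 x4 x1 => F Y1 x1 x2 x3 x4)).
  move=> j k l /(in_box _ _ L2_gt0) b2 /(in_box _ _ L3_gt0) b3.
  move=> /(in_box _ _ L4_gt0) b4; rewrite /F.
  have qE t : boxpt t (j%:R * h2) (k%:R * h3) (l%:R * h4) =
      boxpt 0 (j%:R * h2) (k%:R * h3) (l%:R * h4) + t *: e1
    by exact: boxpt_line1.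
  have bq t : 0 <= t <= L1 -> box (boxpt 0 (j%:R * h2) (k%:R * h3) (l%:R * h4) + t *: e1).
    by move=> bt; exists t, (j%:R * h2), (k%:R * h3), (l%:R * h4); split; rewrite -?qE.
  under eq_bigr do rewrite qE; apply: (@sum_grid_line _ X1 _ _ _ _ _ _ r1) => //.
  - by move=> t /bq bt; case: (dX _ bt).
  - by move=> t /bq bt; case: (XM _ bt).
  - by move=> t s /bq bt; apply/U1/bK.
have up2 : S Y2 <= n%:R ^+ 4 * (2 * M2 / L2 + eta).
  rewrite /S sum_grid4 (sum_grid4 (fun x2 x3 x4 x1 => F Y2 x1 x2 x3 x4)).
  apply: (@sum_grid4_le (fun x3 x4 x1 x2 => F Y2 x1 x2 x3 x4)).
  move=> k l i /(in_box _ _ L3_gt0) b3 /(in_box _ _ L4_gt0) b4.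
  move=> /(in_box _ _ L1_gt0) b1; rewrite /F.
  have qE t : boxpt (i%:R * h1) t (k%:R * h3) (l%:R * h4) =
      boxpt (i%:R * h1) 0 (k%:R * h3) (l%:R * h4) + t *: e2
    by exact: boxpt_line2.
  have bq t : 0 <= t <= L2 -> box (boxpt (i%:R * h1) 0 (k%:R * h3) (l%:R * h4) + t *: e2).
    by move=> bt; exists (i%:R * h1), t, (k%:R * h3), (l%:R * h4); split; rewrite -?qE.
  under eq_bigr do rewrite qE; apply: (@sum_grid_line _ X2 _ _ _ _ _ _ r2) => //.
  - by move=> t /bq bt; case: (dX _ bt).
  - by move=> t /bq bt; case: (XM _ bt).
  - by move=> t s /bq bt; apply/U2/bK.
have up3 : S Y3 <= n%:R ^+ 4 * (2 * M3 / L3 + eta).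
  rewrite /S sum_grid4 (sum_grid4 (fun x2 x3 x4 x1 => F Y3 x1 x2 x3 x4))
    (sum_grid4 (fun x3 x4 x1 x2 => F Y3 x1 x2 x3 x4)).
  apply: (@sum_grid4_le (fun x4 x1 x2 x3 => F Y3 x1 x2 x3 x4)).
  move=> l i j /(in_box _ _ L4_gt0) b4 /(in_box _ _ L1_gt0) b1.
  move=> /(in_box _ _ L2_gt0) b2; rewrite /F.
  have qE t : boxpt (i%:R * h1) (j%:R * h2) t (l%:R * h4) =
      boxpt (i%:R * h1) (j%:R * h2) 0 (l%:R * h4) + t *: e3
    by exact: boxpt_line3.
  have bq t : 0 <= t <= L3 -> box (boxpt (i%:R * h1) (j%:R * h2) 0 (l%:R * h4) + t *: e3).
    by move=> bt; exists (i%:R * h1), (j%:R * h2), t, (l%:R * h4); split; rewrite -?qE.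
  under eq_bigr do rewrite qE; apply: (@sum_grid_line _ X3 _ _ _ _ _ _ r3) => //.
  - by move=> t /bq bt; case: (dX _ bt).
  - by move=> t /bq bt; case: (XM _ bt).
  - by move=> t s /bq bt; apply/U3/bK.
have up4 : S Y4 <= n%:R ^+ 4 * (2 * M4 / L4 + eta).
  rewrite /S.
  apply: (@sum_grid4_le (fun x1 x2 x3 x4 => F Y4 x1 x2 x3 x4)).
  move=> i j k /(in_box _ _ L1_gt0) b1 /(in_box _ _ L2_gt0) b2.
  move=> /(in_box _ _ L3_gt0) b3; rewrite /F.
  have qE t : boxpt (i%:R * h1) (j%:R * h2) (k%:R * h3) t =
      boxpt (i%:R * h1) (j%:R * h2) (k%:R * h3) 0 + t *: e4
    by exact: boxpt_line4.
  have bq t : 0 <= t <= L4 -> box (boxpt (i%:R * h1) (j%:R * h2) (k%:R * h3) 0 + t *: e4).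
    by move=> bt; exists (i%:R * h1), (j%:R * h2), (k%:R * h3), t; split; rewrite -?qE.
  under eq_bigr do rewrite qE; apply: (@sum_grid_line _ X4 _ _ _ _ _ _ r4) => //.
  - by move=> t /bq bt; case: (dX _ bt).
  - by move=> t /bq bt; case: (XM _ bt).
  - by move=> t s /bq bt; apply/U4/bK.
have n4 : 0 < n%:R ^+ 4 :> R by rewrite exprn_gt0 // ltr0n.
rewrite -(ler_pM2l n4); apply: (le_trans lowY); rewrite SY.
apply: (le_trans (lerD (lerD (lerD up1 up2) up3) up4)).
rewrite -!mulrDr ler_pM2l // /eta.
by move: (_ / L1) (_ / L2) (_ / L3) (_ / L4) => ? ? ? ?; lra.
Qed.

End Divergence.

Lemma continuous_sum (R : numFieldType) (T : topologicalType) (W : normedModType R)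
    (I : Type) (r : seq I) (F : I -> T -> W) (x : T) :
  (forall i, {for x, continuous (F i)}) ->
  {for x, continuous (fun y => \sum_(i <- r) F i y)}.
Proof.
move=> cF; rewrite /prop_for /continuous_at; elim: r => [|i r IH].
  by rewrite big_nil; under eq_fun do rewrite big_nil; exact: cvg_cst.
rewrite big_cons; under eq_fun do rewrite big_cons.
by apply: cvgD => //; exact: cF.
Qed.

(** * Coordinates of G and the pullback from the quotient *)

Section CSpace.
Variables (R : realType) (p q : nat).
Notation E := ('M[R]_(p.+1, q.+1) * 'M[R]_(p.+1, q.+1))%type.

Definition cbase (k : bool * ('I_p.+1 * 'I_q.+1)) : E :=
  if k.1 then (0, delta_mx k.2.1 k.2.2) else (delta_mx k.2.1 k.2.2, 0).

Definition ccoef (k : bool * ('I_p.+1 * 'I_q.+1)) (u : E) : R :=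
  (if k.1 then u.2 else u.1) k.2.1 k.2.2.

Lemma cspace_sum u : u = \sum_k ccoef k u *: cbase k.
Proof.
have inl (x : 'M[R]_(p.+1, q.+1)) :
    (x, 0) = \sum_ij x ij.1 ij.2 *: (delta_mx ij.1 ij.2, 0) :> E.
  rewrite {1}[x]matrix_sum_delta pair_big /=.
  apply: (big_ind2 (fun y (z : E) => (y, 0) = z)) => // [y1 z1 y2 z2 <- <-|ij _].
    by congr pair; rewrite addr0.
  by congr pair; rewrite scaler0.
have inr (x : 'M[R]_(p.+1, q.+1)) :
    (0, x) = \sum_ij x ij.1 ij.2 *: (0, delta_mx ij.1 ij.2) :> E.
  rewrite {1}[x]matrix_sum_delta pair_big /=.
  apply: (big_ind2 (fun y (z : E) => (0, y) = z)) => // [y1 z1 y2 z2 <- <-|ij _].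
    by congr pair; rewrite addr0.
  by congr pair; rewrite scaler0.
rewrite -(pair_bigA _ (fun b ij => ccoef (b, ij) u *: cbase (b, ij))) big_bool /=.
rewrite -inl -inr; case: u => x y; congr pair; rewrite ?addr0 ?add0r //.
Qed.

Lemma linear_cspaceE (W : lmodType R) (f : E -> W) u :
  (forall (k : R) u v, f (k *: u + v) = k *: f u + f v) ->
  f u = \sum_k ccoef k u *: f (cbase k).
Proof.
move=> lf; have f0 : f 0 = 0.
  have := lf 1 0 0; rewrite !scale1r addr0 => /(congr1 (fun x => x - f 0)).
  by rewrite subrr addrK.
rewrite {1}[u]cspace_sum.
apply: (big_ind2 (fun (y : E) z => f y = z)) => // [y1 z1 y2 z2 <- <-|k _].
  by rewrite -[y1 in LHS]scale1r lf scale1r.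
by rewrite -[X in f X]addr0 lf f0 addr0.
Qed.

Lemma ccoef_continuous k : continuous (ccoef k).
Proof.
case: k => -[] [i j] u; rewrite /ccoef /=.
  apply: (@continuous_comp _ _ _ snd (fun M : 'M[R]_(p.+1, q.+1) => M i j)).
    exact: cvg_snd.
  exact: coord_continuous.
apply: (@continuous_comp _ _ _ fst (fun M : 'M[R]_(p.+1, q.+1) => M i j)).
  exact: cvg_fst.
exact: coord_continuous.
Qed.

Lemma linear_continuous_cspace (W : normedModType R) (f : E -> W) :
  (forall (k : R) u v, f (k *: u + v) = k *: f u + f v) -> continuous f.
Proof.
move=> lf; have -> : f = fun u => \sum_k ccoef k u *: f (cbase k).
  by apply/funext => u; exact: linear_cspaceE.
move=> u; apply: continuous_sum => k; apply: cvgZr_tmp; exact: ccoef_continuous.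
Qed.

(** The ball is closed in the continuous image of a cube of real coordinates. *)
Lemma compact_cball (M : R) : compact [set u : E | `|u| <= M].
Proof.
pose n := #|{: bool * ('I_p.+1 * 'I_q.+1)}|.
pose F (v : 'rV[R]_n) : E := \sum_k v 0 (enum_rank k) *: cbase k.
have cF : continuous F.
  move=> v; apply: continuous_sum => k; apply: (@cvgZr_tmp _ _ _ _ (nbhs_filter v)).
  exact: (@coord_continuous R 1 n 0 (enum_rank k)).
have cK : compact [set v : 'rV[R]_n | forall i, (`[- M, M]%classic : set R) (v 0 i)].
  by apply: (@rV_compact R n (fun=> `[- M, M]%classic)) => i; exact: segment_compact.
have cFK : compact (F @` [set v : 'rV[R]_n | forall i, (`[- M, M]%classic : set R) (v 0 i)]).
  by apply: continuous_compact => //; exact: continuous_subspaceT.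
apply: subclosed_compact cFK _.
  rewrite (_ : mkset _ = (fun u : E => `|u|) @^-1` [set x | x <= M]) //.
  by apply: preimage_closed => [u _|]; [exact: norm_continuous|exact: closed_le].
move=> u uM; exists (\row_i ccoef (enum_val i) u); last first.
  rewrite /F {2}[u]cspace_sum; apply: eq_bigr => k _.
  by rewrite mxE enum_rankK.
move=> i; rewrite /= mxE in_itv /= -ler_norml; apply: le_trans uM.
rewrite /ccoef prod_normE le_max; case: (enum_val i) => -[] [j k] /=.
  by rewrite ler_mx_norm orbT.
by rewrite ler_mx_norm.
Qed.

End CSpace.

Section Coordinates.
Variables (R : realType) (m : nat).
Notation d := (2 * m).+1.
Notation E := ('M[R]_(d.+1, m.+1) * 'M[R]_(d.+1, m.+1))%type.
Implicit Types (z u v : E) (x t : R) (a : 'rV[R]_d) (b : 'cV[R]_d) (c : 'M[R]_d).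

Definition alpha_of z : R := z.2 ord0 ord0.
Definition a_of z : 'rV[R]_d := \row_k coord_row z ord0 k.
Definition b_of z : 'cV[R]_d := \col_i z.2 (lift ord0 i) ord0.
Definition c_of z : 'M[R]_d := \matrix_(i, k) coord_row z (lift ord0 i) k.

Lemma of_coordE z : of_coord z = Gmx (alpha_of z) (a_of z) (b_of z) (c_of z).
Proof. by []. Qed.

(** The inverse of the coordinates. A row is listed as (x_i0, y_i1, x_i1, ...), so x_ij has position
    2j and y_ij position 2j - 1; the entries y_i0 come from t and b. *)
Definition mk_coord t a b c : E :=
  let r (i : 'I_d.+1) (k : nat) : R :=
    if unlift ord0 i is Some i' then c i' (inord k) else a 0 (inord k) in
  (\matrix_(i, j) r i j.*2,
   \matrix_(i, j) if j == 0 then (if unlift ord0 i is Some i' then b i' 0 else t)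
                  else r i j.*2.-1).

Lemma alpha_of_mk t a b c : alpha_of (mk_coord t a b c) = t.
Proof. by rewrite /alpha_of mxE eqxx unlift_none. Qed.

Lemma b_of_mk t a b c : b_of (mk_coord t a b c) = b.
Proof. by apply/matrixP => i j; rewrite !mxE eqxx liftK ord1. Qed.

Lemma coord_row_mk t a b c i k :
  coord_row (mk_coord t a b c) i k =
  if unlift ord0 i is Some i' then c i' k else a 0 k.
Proof.
have km : (uphalf k < m.+1)%N by have := ltn_ord k; rewrite ltnS -leq_double; lia.
rewrite /coord_row; case: ifP => ok; rewrite mxE /= inordK //.
  have -> : (inord (uphalf k) == 0 :> 'I_m.+1) = false.
    by apply/negbTE; rewrite -val_eqE /= inordK //; lia.
  by rewrite odd_uphalfK //= inord_val.
by rewrite even_uphalfK ?ok // inord_val.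
Qed.

Lemma a_of_mk t a b c : a_of (mk_coord t a b c) = a.
Proof. by apply/matrixP => i j; rewrite mxE coord_row_mk unlift_none ord1. Qed.

Lemma c_of_mk t a b c : c_of (mk_coord t a b c) = c.
Proof. by apply/matrixP => i j; rewrite mxE coord_row_mk liftK. Qed.

Lemma mk_coordK z : mk_coord (alpha_of z) (a_of z) (b_of z) (c_of z) = z.
Proof.
have rE i k : (k < d)%N ->
    (if unlift ord0 i is Some i' then c_of z i' (inord k) else a_of z 0 (inord k))
    = coord_row z i (inord k).
  by move=> kd; case: unliftP => [i' ->|->]; rewrite mxE.
case: z rE => x y rE; congr pair; apply/matrixP => i j; rewrite mxE.
  rewrite rE; last by have := ltn_ord j; lia.
  rewrite /coord_row inordK; last by have := ltn_ord j; lia.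
  by rewrite odd_double /= uphalf_double inord_val.
case: eqP => [->|/eqP]; first by case: unliftP => [i' ->|->]; rewrite ?mxE.
rewrite -val_eqE /= => j0; rewrite rE; last by have := ltn_ord j; lia.
rewrite /coord_row inordK; last by have := ltn_ord j; lia.
have [j' jE] : exists j', j = j'.+1 :> nat by exists j.-1; lia.
have -> : j.*2.-1 = j'.*2.+1 by rewrite jE.
by rewrite /= odd_double /= doubleK -jE inord_val.
Qed.

Lemma of_coord_inj : injective (@of_coord R d m).
Proof.
move=> z z'; rewrite !of_coordE => /Gmx_inj[E1 E2 E3 E4].
by rewrite -[z]mk_coordK -[z']mk_coordK E1 E2 E3 E4.
Qed.

Lemma mk_coord_linear k t a b c t' a' b' c' :
  mk_coord (k * t + t') (k *: a + a') (k *: b + b') (k *: c + c') =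
  k *: mk_coord t a b c + mk_coord t' a' b' c'.
Proof.
congr pair; apply/matrixP => i j; rewrite !mxE.
  by case: unlift => [i'|]; rewrite ?mxE.
by case: ifP => _; case: unlift => [i'|]; rewrite ?mxE.
Qed.

Lemma alpha_of_linear k u v : alpha_of (k *: u + v) = k * alpha_of u + alpha_of v.
Proof. by rewrite /alpha_of !mxE. Qed.

Lemma coord_row_linear k u v i j :
  coord_row (k *: u + v) i j = k * coord_row u i j + coord_row v i j.
Proof. by rewrite /coord_row; case: ifP; rewrite !mxE. Qed.

Lemma a_of_linear k u v : a_of (k *: u + v) = k *: a_of u + a_of v.
Proof. by apply/matrixP => i j; rewrite !mxE coord_row_linear. Qed.

Lemma b_of_linear k u v : b_of (k *: u + v) = k *: b_of u + b_of v.
Proof. by apply/matrixP => i j; rewrite !mxE. Qed.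

Lemma c_of_linear k u v : c_of (k *: u + v) = k *: c_of u + c_of v.
Proof. by apply/matrixP => i j; rewrite !mxE coord_row_linear. Qed.

Lemma alpha_of_continuous : continuous alpha_of.
Proof. exact: (linear_continuous_cspace (W := R^o) alpha_of_linear). Qed.

Lemma a_of_continuous : continuous a_of.
Proof. exact: (linear_continuous_cspace a_of_linear). Qed.

Lemma b_of_continuous : continuous b_of.
Proof. exact: (linear_continuous_cspace b_of_linear). Qed.

Lemma c_of_continuous : continuous c_of.
Proof. exact: (linear_continuous_cspace c_of_linear). Qed.

Definition trans_linear x b u : E :=
  mk_coord (x * alpha_of u) (x *: a_of u) (b_of u + alpha_of u *: b)
           (c_of u + b *m a_of u).

Definition translate x a b c z : E := trans_linear x b z + mk_coord 0 a 0 c.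

Lemma trans_linear_linear x b k u v :
  trans_linear x b (k *: u + v) = k *: trans_linear x b u + trans_linear x b v.
Proof.
rewrite /trans_linear -mk_coord_linear alpha_of_linear a_of_linear b_of_linear.
rewrite c_of_linear mulmxDr -scalemxAr !scalerDr scalerDl scalerA mulrDr.
congr mk_coord.
- by rewrite mulrCA.
- by rewrite !scalerA mulrC.
- by rewrite -!scalerA addrACA.
- by rewrite addrACA.
Qed.

Lemma of_coord_mk t a b c : of_coord (mk_coord t a b c) = Gmx t a b c.
Proof. by rewrite of_coordE alpha_of_mk a_of_mk b_of_mk c_of_mk. Qed.

Lemma translateE x a b c z : translate x a b c z =
  mk_coord (x * alpha_of z) (x *: a_of z + a) (b_of z + alpha_of z *: b)
           (c_of z + b *m a_of z + c).
Proof.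
rewrite /translate /trans_linear -[X in X + _]scale1r -mk_coord_linear.
by rewrite mul1r !scale1r !addr0.
Qed.

Lemma of_coord_translate x a b c z :
  of_coord (translate x a b c z) = Gmx x a b c *m of_coord z.
Proof. by rewrite translateE of_coord_mk of_coordE Gmx_mul. Qed.

Lemma mk_coord_norm t a b c M :
  `|t| <= M -> `|a| <= M -> `|b| <= M -> `|c| <= M -> `|mk_coord t a b c| <= M.
Proof.
move=> tM aM bM cM; have M0 : 0 <= M by exact: le_trans tM.
rewrite prod_normE ge_max; apply/andP; split; apply: mx_norm_le => // i j;
  rewrite mxE; first by case: unlift => [i'|]; apply: le_trans (ler_mx_norm _ _ _) _.
case: ifP => _; first by case: unlift => [i'|] //; apply: le_trans (ler_mx_norm _ _ _) _.
by case: unlift => [i'|]; apply: le_trans (ler_mx_norm _ _ _) _.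
Qed.

End Coordinates.

Lemma diff_near_affine (R : numFieldType) (V W : normedModType R) (f : V -> W)
    (T : {linear V -> W}) (w : W) (x : V) :
  continuous T -> (\forall y \near x, f y = T y + w) -> 'd f x = T :> (V -> W).
Proof.
move=> cT fT; apply: diff_unique => //.
have fx : f x = T x + w by exact: nbhs_singleton fT.
apply/eqaddoP => eps eps0.
have cs : (h + x) @[h --> (0 : V)] --> x.
  by rewrite -{2}[x]add0r; apply: cvgD; [exact: cvg_id|exact: cvg_cst].
have fT0 : \forall h \near (0 : V), f (h + x) = T (h + x) + w := cs _ fT.
apply: filterS fT0 => h fh.
rewrite !fctE /= fh fx linearD (addrC (T h)) (addrAC (T x)) subrr normr0.
by rewrite mulr_ge0 // ltW.
Qed.

Lemma near_eq_differentiable (R : numFieldType) (V W : normedModType R)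
    (f g : V -> W) (x : V) :
  (\forall y \near x, g y = f y) -> differentiable f x -> differentiable g x.
Proof.
move=> gf df; have gx : g x = f x by exact: nbhs_singleton gf.
have /diff_locallyP[cdf fE] := df.
have gE : g \o shift x = cst (g x) + 'd f x +o_ (0 : V) id.
  apply/eqaddoP => eps eps0; have /eqaddoP/(_ _ eps0) := fE.
  have cs : (h + x) @[h --> (0 : V)] --> x.
    by rewrite -{2}[x]add0r; apply: cvgD; [exact: cvg_id|exact: cvg_cst].
  have gf0 : \forall h \near (0 : V), g (h + x) = f (h + x) := cs _ gf.
  by apply: filterS2 gf0 => h gh; rewrite !fctE /= gh gx.
by apply/diff_locallyP; rewrite (diff_unique cdf gE).
Qed.

Section Quotient.
Variables (R : realType) (m : nat).
Notation d := (2 * m).+1.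
Notation E := ('M[R]_(d.+1, m.+1) * 'M[R]_(d.+1, m.+1))%type.
Variable L : set 'M[R]_(d + (1 + d)).
Hypothesis L1 : L 1%:M.
Hypothesis LM : forall g h, L g -> L h -> L (g *m h).
Hypothesis LV : forall g, L g -> L (invmx g).
Hypothesis Linj : forall z : E, 0 < alpha_of z -> exists2 r, 0 < r &
  forall z1 z2 l, ball z r z1 -> ball z r z2 -> L l ->
  of_coord z2 = l *m of_coord z1 -> z1 = z2.

HB.instance Definition _ (x : R) (b : 'cV[R]_d) :=
  GRing.isLinear.Build R E E *:%R (trans_linear x b) (trans_linear_linear x b).

Let Atlas := quotient_atlas (m := m) L.

Lemma coset_translate x a b c (z : E) : 0 < x -> L (Gmx x a b c) ->
  coset_of_coord L (translate x a b c z) = coset_of_coord L z.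
Proof.
move=> x0 Ll; apply/seteqP; split => g [l Lk <-].
  by exists (l *m Gmx x a b c); rewrite ?of_coord_translate ?mulmxA //; exact: LM.
exists (l *m invmx (Gmx x a b c)); first by apply: LM => //; exact: LV.
rewrite of_coord_translate -mulmxA (mulmxA (invmx _)) mulVmx ?mul1mx //.
by rewrite Gmx_unit ?gt_eqF.
Qed.

Lemma coset_eq_mul (z1 z2 : E) : coset_of_coord L z1 = coset_of_coord L z2 ->
  exists2 l, L l & of_coord z2 = l *m of_coord z1.
Proof.
move=> e; have : coset_of_coord L z2 (of_coord z2) by exists 1%:M; rewrite ?mul1mx.
by rewrite -e => -[l Ll <-]; exists l.
Qed.

Lemma chart_exists (z : E) : 0 < alpha_of z ->
  exists ch : chart R d m (set 'M[R]_(d + (1 + d))), Atlas ch /\ cdom ch z.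
Proof.
move=> z0; have [r r0 inj] := Linj z0.
exists (Chart (ball z r `&` [set z : E | 0 < z.2 ord0 ord0]) (coset_of_coord L)).
split; last by split => //=; exact: ballxx.
split=> //=.
- apply: openI; first exact: ball_open.
  rewrite (_ : mkset _ = (@alpha_of R m) @^-1` [set x | 0 < x]) //.
  by apply: open_comp => [y _|]; [exact: alpha_of_continuous|exact: open_gt].
- move=> y1 y2; rewrite !inE => -[B1 _] [B2 _] /coset_eq_mul[l Ll e].
  exact: inj B1 B2 Ll e.
Qed.

(** The translate of a point near z stays in the open domain of [ch'] and represents the same coset.
    Since the projection is injective on that domain, the partial inverse returns exactly this
    translate. *)
Lemma transition_near (ch ch' : chart R d m _) x a b c (z : E) :
  Atlas ch -> Atlas ch' -> 0 < x -> L (Gmx x a b c) ->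
  cdom ch z -> cdom ch' (translate x a b c z) ->
  [/\ transition_dom ch ch' z, transition ch ch' z = translate x a b c z &
      'd (transition ch ch') z = trans_linear x b :> (E -> E)].
Proof.
move=> [_ _ _ pE] [op' _ inj' pE'] x0 Ll cz cz'.
have ct : continuous (translate x a b c).
  move=> y; apply: cvgD; last exact: cvg_cst.
  exact: (linear_continuous_cspace (trans_linear_linear x b)).
have tE y : cdom ch' (translate x a b c y) ->
    transition ch ch' y = translate x a b c y.
  move=> cy; rewrite /transition /= pE -(coset_translate y x0 Ll) -pE'.
  by rewrite pinvKV ?inE // pE'.
split; last 2 first.
- exact: tE.
- apply: (@diff_near_affine _ _ _ _ (trans_linear x b) (mk_coord 0 a 0 c)).
    exact: (linear_continuous_cspace (trans_linear_linear x b)).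
  have : \forall y \near z, cdom ch' (translate x a b c y).
    by apply: ct; exact: open_nbhs_nbhs.
  by apply: filterS => y; exact: tE.
split=> //; exists (translate x a b c z) => //.
by rewrite pE pE' coset_translate.
Qed.

(* G and theta are the pullbacks to the half space alpha_of z > 0; [lc_inv] and
   [lc_theta_inv] are their invariance under L, which acts by the affine maps
   [translate x a b c] with linear part [trans_linear x b]. *)
Record lck_cover (G : E -> E -> E -> R) (theta : E -> E -> R) : Prop := LckCover {
  lc_lin : forall z k u u' v, G z (k *: u + u') v = k * G z u v + G z u' v;
  lc_sym : forall z u v, G z u v = G z v u;
  lc_pos : forall z u, 0 < alpha_of z -> u != 0 -> 0 < G z u u;
  lc_J : forall z u v, G z (Jmap u) (Jmap v) = G z u v;
  lc_dif : forall u v z, 0 < alpha_of z -> differentiable (fun y => G y u v) z;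
  lc_C1 : forall u v w z, 0 < alpha_of z ->
    {for z, continuous ('D_w (fun y => G y u v))};
  lc_theta_lin : forall z k u v, theta z (k *: u + v) = k * theta z u + theta z v;
  lc_theta_dif : forall u z, 0 < alpha_of z -> differentiable (theta^~ u) z;
  lc_theta_C1 : forall u w z, 0 < alpha_of z ->
    {for z, continuous ('D_w (theta^~ u))};
  lc_closed : forall u v z, 0 < alpha_of z -> ext_d1 theta z u v = 0;
  lc_lck : forall u v w z, 0 < alpha_of z ->
    ext_d2 (fun y u v => G y (Jmap u) v) z u v w =
    wedge12 theta (fun y u v => G y (Jmap u) v) z u v w;
  lc_inv : forall x a b c z u v, 0 < x -> L (Gmx x a b c) -> 0 < alpha_of z ->
    G (translate x a b c z) (trans_linear x b u) (trans_linear x b v) = G z u v;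
  lc_theta_inv : forall x a b c z u, 0 < x -> L (Gmx x a b c) -> 0 < alpha_of z ->
    theta (translate x a b c z) (trans_linear x b u) = theta z u
}.

Lemma lck_pullback g : lck_metric Atlas g -> exists G theta, lck_cover G theta.
Proof.
move=> [[gP gS gT] [th [[thP thS thT] thC] lck]].
have [ch chP] : exists ch : E -> chart R d m (set 'M[R]_(d + (1 + d))),
    forall z, 0 < alpha_of z -> Atlas (ch z) /\ cdom (ch z) z.
  suff /choice[ch chP] : forall z : E, exists c : chart R d m (set 'M[R]_(d + (1 + d))),
      0 < alpha_of z -> Atlas c /\ cdom c z by exists ch.
  move=> z; have [/chart_exists[c cP]|_] := ltP 0 (alpha_of z); first by exists c.
  by exists (Chart set0 (fun=> set0)).
(* The value 0 outside the half space lets linearity, symmetry and J-invariance hold at every z. *)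
pose G z u v := if 0 < alpha_of z then g (ch z) z u v else 0.
pose theta z u := if 0 < alpha_of z then th (ch z) z u else 0.
have translate1 (z : E) : translate 1 0 0 0 z = z.
  by rewrite translateE mul1r scale1r scaler0 mul0mx !addr0 mk_coordK.
have trans1 (u : E) : trans_linear 1 0 u = u.
  by rewrite /trans_linear mul1r scale1r scaler0 mul0mx !addr0 mk_coordK.
have L11 : L (Gmx 1 0 0 0) by rewrite Gmx1.
have cpos c z : Atlas c -> cdom c z -> 0 < alpha_of z.
  by move=> [_ cH _ _] cz; exact: cH.
have alpha_tr x a b c (z : E) : 0 < x -> 0 < alpha_of z -> 0 < alpha_of (translate x a b c z).
  by move=> x0 z0; rewrite translateE alpha_of_mk mulr_gt0.
(* For the identity of L this is independence of the chart ([GE]); for a general element it gives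
   invariance under L. *)
have gch c z u v x a b k : Atlas c -> 0 < x -> L (Gmx x a b k) -> 0 < alpha_of z ->
    cdom c (translate x a b k z) ->
    G z u v = g c (translate x a b k z) (trans_linear x b u) (trans_linear x b v).
  move=> Ac x0 Ll z0 cz; rewrite /G z0; have [Az cz'] := chP _ z0.
  have [T1 T2 T3] := transition_near Az Ac x0 Ll cz' cz.
  by rewrite (gT _ _ Az Ac _ T1) T2 T3.
have thch c z u x a b k : Atlas c -> 0 < x -> L (Gmx x a b k) -> 0 < alpha_of z ->
    cdom c (translate x a b k z) ->
    theta z u = th c (translate x a b k z) (trans_linear x b u).
  move=> Ac x0 Ll z0 cz; rewrite /theta z0; have [Az cz'] := chP _ z0.
  have [T1 T2 T3] := transition_near Az Ac x0 Ll cz' cz.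
  by rewrite (thT _ _ Az Ac _ T1) T2 T3.
have GE c z u v : Atlas c -> cdom c z -> G z u v = g c z u v.
  move=> Ac cz; rewrite (gch c z u v 1 0 0 0) ?translate1 ?trans1 //.
  exact: cpos cz.
have thetaE c z u : Atlas c -> cdom c z -> theta z u = th c z u.
  move=> Ac cz; rewrite (thch c z u 1 0 0 0) ?translate1 ?trans1 //.
  exact: cpos cz.
have nearG u v z c : Atlas c -> cdom c z -> \forall y \near z, G y u v = g c y u v.
  move=> Ac cz; have [oc _ _ _] := Ac.
  have : nbhs z (cdom c) by exact: open_nbhs_nbhs.
  by apply: filterS => y; exact: GE.
have nearth u z c : Atlas c -> cdom c z -> \forall y \near z, theta y u = th c y u.
  move=> Ac cz; have [oc _ _ _] := Ac.
  have : nbhs z (cdom c) by exact: open_nbhs_nbhs.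
  by apply: filterS => y; exact: thetaE.
have smoothC1 c (f F : E -> R) z w : Atlas c -> cdom c z -> smooth (cdom c) F ->
    (forall y, cdom c y -> \forall x \near y, f x = F x) ->
    {for z, continuous ('D_w f)}.
  move=> Ac cz sF fF; have [oc _ _ _] := Ac.
  have dF : \forall y \near z, 'D_w f y = 'D_w F y.
    have : nbhs z (cdom c) by exact: open_nbhs_nbhs.
    by apply: filterS => y cy; apply: near_eq_derive; exact: fF.
  have [_ /(_ w)/(_ z cz) cF] := sF 1%N.
  rewrite /prop_for /continuous_at (nbhs_singleton dF).
  apply: cvg_trans cF; apply: near_eq_cvg.
  by apply: filterS dF => y ->.
exists G, theta; split.
- move=> z k u u' v; rewrite /G; case: ifP => [z0|_]; last by rewrite mulr0 addr0.
  by have [Az cz] := chP _ z0; have [-> _ _ _] := gP _ _ Az cz.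
- move=> z u v; rewrite /G; case: ifP => [z0|_] //.
  by have [Az cz] := chP _ z0; have [_ h _ _] := gP _ _ Az cz.
- move=> z u z0 u0; rewrite /G z0.
  by have [Az cz] := chP _ z0; have [_ _ h _] := gP _ _ Az cz; exact: h.
- move=> z u v; rewrite /G; case: ifP => [z0|_] //.
  by have [Az cz] := chP _ z0; have [_ _ _ h] := gP _ _ Az cz; exact: h.
- move=> u v z z0; have [Az cz] := chP _ z0.
  apply: (near_eq_differentiable (nearG u v z _ Az cz)).
  by have [h _] := gS _ Az u v 1%N; exact: h.
- move=> u v w z z0; have [Az cz] := chP _ z0.
  by apply: (smoothC1 _ _ _ _ _ Az cz (gS _ Az u v)) => y cy; exact: nearG.
- move=> z k u v; rewrite /theta; case: ifP => [z0|_]; last by rewrite mulr0 addr0.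
  by have [Az cz] := chP _ z0; exact: thP.
- move=> u z z0; have [Az cz] := chP _ z0.
  apply: (near_eq_differentiable (nearth u z _ Az cz)).
  by have [h _] := thS _ Az u 1%N; exact: h.
- move=> u w z z0; have [Az cz] := chP _ z0.
  by apply: (smoothC1 _ _ _ _ _ Az cz (thS _ Az u)) => y cy; exact: nearth.
- move=> u v z z0; have [Az cz] := chP _ z0; rewrite -(thC _ _ Az cz u v) /ext_d1.
  by congr (_ - _); apply: near_eq_derive; exact: nearth.
- move=> u v w z z0; have [Az cz] := chP _ z0; have := lck _ _ Az cz u v w.
  rewrite /ext_d2 /wedge12 /fundamental_form !(thetaE _ _ _ Az cz) !(GE _ _ _ _ Az cz) => <-.
  by congr (_ - _ + _); apply: near_eq_derive; exact: nearG.
- move=> x a b c z u v x0 Ll z0; have tz := alpha_tr x a b c z x0 z0.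
  have [Az cz] := chP _ tz.
  by rewrite (gch _ _ _ _ _ _ _ _ Az x0 Ll z0 cz) (GE _ _ _ _ Az cz).
- move=> x a b c z u x0 Ll z0; have tz := alpha_tr x a b c z x0 z0.
  have [Az cz] := chP _ tz.
  by rewrite (thch _ _ _ _ _ _ _ Az x0 Ll z0 cz) (thetaE _ _ _ Az cz).
Qed.

End Quotient.

Lemma alpha_of_open (R : realType) (m : nat) :
  open [set z : 'M[R]_((2 * m).+2, m.+1) * 'M[R]_((2 * m).+2, m.+1) | 0 < alpha_of z].
Proof.
rewrite (_ : mkset _ = (@alpha_of R m) @^-1` [set x | 0 < x]) //.
by apply: open_comp => [y _|]; [exact: alpha_of_continuous|exact: open_gt].
Qed.

Lemma ltz1_eq0 (n : int) : -1 < n -> n < 1 -> n = 0.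
Proof. by lia. Qed.

Section LocallyFree.
Variables (R : realType) (m : nat).
Notation d := (2 * m).+1.
Notation E := ('M[R]_(d.+1, m.+1) * 'M[R]_(d.+1, m.+1))%type.
Variables (alpha : R) (nil : 'rV[R]_d -> 'cV[R]_d -> 'M[R]_d -> Prop).
Hypothesis alpha_gt1 : 1 < alpha.

(** The entries of l are eliminated one after the other: the ratio of the t-coordinates forces n =
    0, the differences of the a- and b-coordinates bound A and B, and once B = 0 the difference of
    the c-coordinates is C. *)
Lemma locally_free (L : set 'M[R]_(d + (1 + d))) (e : R) :
  (forall g, L g -> exists n A B C,
     nil A B C /\ g = Gmx (alpha ^ n) (alpha ^ n *: A) B C) ->
  0 < e ->
  (forall A B C, nil A B C -> `|A| < e -> `|B| < e ->
     [/\ A = 0, B = 0 & `|C| < e -> C = 0]) ->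
  forall z : E, 0 < alpha_of z -> exists2 r, 0 < r &
  forall z1 z2 l, ball z r z1 -> ball z r z2 -> L l ->
  of_coord z2 = l *m of_coord z1 -> z1 = z2.
Proof.
move=> hL e0 hnil z z0; have a0 : 0 < alpha by exact: lt_trans alpha_gt1.
(* Chosen so that the ends (1 - dl) t = dl' t and (1 + dl) t = alpha dl' t of the window around t
   have ratio alpha. Two points inside then have a ratio strictly between 1 / alpha and alpha. *)
pose dl := (alpha - 1) / (alpha + 1).
pose dl' := 2 / (alpha + 1).
have dlE : dl + dl' = 1 by rewrite /dl /dl'; field; rewrite gt_eqF // addr_gt0.
have dlE2 : 1 + dl = alpha * dl' by rewrite /dl /dl'; field; rewrite gt_eqF // addr_gt0.
have dl_gt0 : 0 < dl by rewrite divr_gt0 ?subr_gt0 ?addr_gt0.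
have dl'_gt0 : 0 < dl' by rewrite divr_gt0 ?addr_gt0.
set t := alpha_of z in z0.
(* The bound for b has the extra factor dl' t because B occurs there multiplied by [alpha_of z1],
   which exceeds dl' t. *)
have [r r0 Hr] : exists2 r, 0 < r & forall y : E, ball z r y ->
    [/\ `|t - alpha_of y| < dl * t, `|a_of z - a_of y| < e / 2,
     `|b_of z - b_of y| < e / 2 * (dl' * t) & `|c_of z - c_of y| < e / 2].
  have near_lt (W : normedModType R) (f : E -> W) (eps : R) : continuous f -> 0 < eps ->
      \forall y \near z, `|f z - f y| < eps.
    by move=> /(_ z)/cvgrPdist_lt; apply.
  have N1 := near_lt R^o _ (dl * t) (@alpha_of_continuous R m) (mulr_gt0 dl_gt0 z0).
  have N2 := near_lt _ _ (e / 2) (@a_of_continuous R m) (divr_gt0 e0 (ltr0Sn _ _)).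
  have N3 := near_lt _ _ (e / 2 * (dl' * t)) (@b_of_continuous R m)
    (mulr_gt0 (divr_gt0 e0 (ltr0Sn _ _)) (mulr_gt0 dl'_gt0 z0)).
  have N4 := near_lt _ _ (e / 2) (@c_of_continuous R m) (divr_gt0 e0 (ltr0Sn _ _)).
  have : \forall y \near z, 
    [/\ `|t - alpha_of y| < dl * t, `|a_of z - a_of y| < e / 2,
     `|b_of z - b_of y| < e / 2 * (dl' * t) & `|c_of z - c_of y| < e / 2].
    by near=> y; split; near: y.
  by move=> /nbhs_ballP[r r0 Hr]; exists r => // y /Hr.
exists r => // z1 z2 l /Hr[t1 x1 y1 w1] /Hr[t2 x2 y2 w2] /hL[n [A [B [C [H ->]]]]].
rewrite -of_coord_translate => /of_coord_inj ez2.
have close (W : normedModType R) (u v w : W) (eps : R) :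
    `|u - v| < eps / 2 -> `|u - w| < eps / 2 -> `|w - v| < eps.
  move=> h1 h2; have := ler_normB (u - v) (u - w).
  by rewrite opprB addrC addrA subrK => ?; lra.
have lo y : `|t - y| < dl * t -> dl' * t < y < alpha * (dl' * t).
  rewrite ltr_norml mulrA -dlE2 => /andP[h1 h2].
  by have := congr1 ( *%R^~ t) dlE; rewrite /= !mulrDl => ?; apply/andP; split; lra.
have /andP[t1l t1u] := lo _ t1; have /andP[t2l t2u] := lo _ t2.
have dt0 : 0 < dl' * t by rewrite mulr_gt0.
have n0 : n = 0.
  have tE : alpha_of z2 = alpha ^ n * alpha_of z1 by rewrite ez2 translateE alpha_of_mk.
  have t1_gt0 : 0 < alpha_of z1 by exact: lt_trans t1l.
  have n1 : n < 1.
    rewrite -(ltr_eXz2l alpha_gt1) expr1z ltNge; apply/negP => an.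
    have : alpha * alpha_of z1 <= alpha_of z2 by rewrite tE ler_pM2r.
    rewrite leNgt => /negP; apply; apply: (lt_trans t2u).
    by rewrite ltr_pM2l.
  have n1' : -1 < n.
    rewrite -(ltr_eXz2l alpha_gt1) exprN1 ltNge; apply/negP => an.
    have : alpha_of z2 <= alpha^-1 * alpha_of z1 by rewrite tE ler_pM2r.
    rewrite leNgt => /negP; apply; apply: lt_trans t2l.
    by rewrite mulrC ltr_pdivrMr // mulrC.
  exact: ltz1_eq0.
move: ez2; rewrite n0 expr0z scale1r translateE mul1r scale1r => ez2.
have A_small : `|A| < e.
  have -> : A = a_of z2 - a_of z1 by rewrite ez2 a_of_mk addrC addKr.
  exact: close x1 x2.
have B_small : `|B| < e.
  have tB : `|alpha_of z1 *: B| < e * (dl' * t).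
    have -> : alpha_of z1 *: B = b_of z2 - b_of z1 by rewrite ez2 b_of_mk addrC addKr.
    by apply: close; rewrite mulrAC; [exact: y1|exact: y2].
  move: tB; rewrite normrZ gtr0_norm ?(lt_trans dt0) // => tB.
  have : alpha_of z1 * `|B| < alpha_of z1 * e.
    by apply: (lt_trans tB); rewrite mulrC ltr_pM2r.
  by rewrite ltr_pM2l // (lt_trans dt0).
have [A0 B0 C0] := hnil _ _ _ H A_small B_small.
have C_small : `|C| < e.
  have -> : C = c_of z2 - c_of z1.
    by rewrite ez2 c_of_mk B0 mul0mx addr0 addrC addKr.
  exact: close w1 w2.
by rewrite ez2 A0 B0 (C0 C_small) scaler0 mul0mx !addr0 mk_coordK.
Unshelve. all: by end_near. Qed.

End LocallyFree.

(** * The divergence argument *)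

Section Analysis.
Variables (R : realType) (m : nat).
Notation d := (2 * m).+1.
Notation E := ('M[R]_(d.+1, m.+1) * 'M[R]_(d.+1, m.+1))%type.
Implicit Types (z u v : E) (A : 'rV[R]_d) (B : 'cV[R]_d) (C : 'M[R]_d).

Lemma continuous_pairing (f : E -> E -> R) (V : E -> E) z :
  (forall y (k : R) u v, f y (k *: u + v) = k * f y u + f y v) ->
  (forall u, {for z, continuous (f^~ u)}) -> continuous V ->
  {for z, continuous (fun y => f y (V y))}.
Proof.
move=> lf cf cV.
have -> : (fun y => f y (V y)) = fun y => \sum_k ccoef k (V y) * f y (cbase R k).
  by apply/funext => y; rewrite (@linear_cspaceE R _ _ R^o (f y)) //; exact: lf.
apply: continuous_sum => k; apply: cvgM; last exact: cf.
by apply: (continuous_comp (cV z)); exact: ccoef_continuous.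
Qed.

Lemma segment_MVT (f : E -> R) (df : E -> E -> R) x y :
  (forall t : R, 0 <= t <= 1 ->
     is_derive (x + t *: (y - x)) (y - x) f (df (x + t *: (y - x)) (y - x))) ->
  exists2 t : R, 0 <= t <= 1 & f y - f x = df (x + t *: (y - x)) (y - x).
Proof.
move=> hf; pose F (t : R) := f (x + t *: (y - x)).
pose dF (t : R) := df (x + t *: (y - x)) (y - x).
have hF (t : R) : 0 <= t <= 1 -> is_derive t 1 F (dF t).
  by move=> t1; apply/is_derive_lineP; exact: hf.
have h1 (t : R) : t \in `]0, 1[ -> is_derive t 1 F (dF t).
  by move=> /subset_itv_oo_cc; rewrite in_itv; exact: hF.
have h2 : {within `[0, 1], continuous F}.
  apply: continuous_in_subspaceT => t; rewrite inE /= in_itv /= => /hF[d1 _].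
  exact/differentiable_continuous/derivable1_diffP.
have [t t01] := MVT_segment ler01 h1 h2.
rewrite /F /dF scale1r scale0r addr0 [x + (y - x)]addrC subrK subr0 mulr1 => e.
by exists t => //; move: t01; rewrite in_itv.
Qed.

Variables (L : set 'M[R]_(d + (1 + d))) (G : E -> E -> E -> R) (theta : E -> E -> R).
Hypothesis hC : lck_cover L G theta.

Let H : set E := [set z | 0 < alpha_of z].
Let z1 : E := mk_coord 1 0 0 0.

Lemma alpha_of_segment x y (t : R) : H x -> H y -> 0 <= t <= 1 ->
  H (x + t *: (y - x)).
Proof.
rewrite /H /= => Hx Hy /andP[t0 t1]; rewrite addrC alpha_of_linear.
have -> : y - x = -1 *: x + y by rewrite scaleN1r addrC.
rewrite alpha_of_linear mulN1r.
have -> : t * (- alpha_of x + alpha_of y) + alpha_of x =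
  (1 - t) * alpha_of x + t * alpha_of y by ring.
have := t0; rewrite le_eqVlt => /orP[/eqP <-|t0'].
  by rewrite subr0 mul1r mul0r addr0.
by rewrite ltr_wpDl ?mulr_ge0 ?subr_ge0 ?(ltW Hx) // mulr_gt0.
Qed.

Lemma lee_potential_exists :
  exists phi : E -> R, forall z u, H z -> is_derive z u phi (theta z u).
Proof.
exists (radial_primitive z1 theta) => z u Hz; apply: (@radial_primitive_derive R _ H) => //.
- exact: alpha_of_open.
- by move=> x t Hx t1; apply: alpha_of_segment => //; rewrite /H /= alpha_of_mk.
- exact: (lc_theta_lin hC).
- by move=> v x; exact: (lc_theta_dif hC).
- by move=> v w x; exact: (lc_theta_C1 hC).
- by move=> v w x Hx; have /eqP := lc_closed hC v w Hx; rewrite subr_eq0 => /eqP.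
Qed.

Variable phi : E -> R.
Hypothesis lee_potentialP : forall z u, H z -> is_derive z u phi (theta z u).

(** Directional derivatives alone do not give continuity. Near z, however, theta is bounded on a
    basis, and the mean value theorem on segments turns this into a Lipschitz type estimate. *)
Lemma lee_potential_continuous z : H z -> {for z, continuous phi}.
Proof.
move=> Hz; pose C k := `|theta z (cbase R k)| + 1.
have near_bnd : \forall y \near z, H y /\ forall k, `|theta y (cbase R k)| < C k.
  have N1 : \forall y \near z, H y by apply: open_nbhs_nbhs; split => //; exact: alpha_of_open.
  have N2 : \forall y \near z, forall k, `|theta y (cbase R k)| < C k.
    apply: (@filter_forall _ _ (fun k (y : E) => `|theta y (cbase R k)| < C k) (nbhs z)) => k.
    have ct : {for z, continuous (theta^~ (cbase R k))}.
      by apply: differentiable_continuous; exact: (lc_theta_dif hC).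
    have /cvgr_norm_lt : `|theta z (cbase R k)| < C k by rewrite ltrDl.
    by apply; exact: ct.
  by near=> y; split; near: y.
have [r r0 Hr] : exists2 r, 0 < r & forall y : E, ball z r y ->
    H y /\ forall k, `|theta y (cbase R k)| < C k.
  by move: near_bnd => /nbhs_ballP[r r0 Hr]; exists r => // y /Hr.
have bnd y : ball z r y -> `|phi y - phi z| <= \sum_k `|ccoef k (y - z)| * C k.
  move=> zy; have seg (t : R) : 0 <= t <= 1 -> ball z r (z + t *: (y - z)).
    move=> /andP[t0 t1]; move: zy; rewrite -ball_normE /= opprD addrA subrr sub0r normrN.
    by rewrite distrC; apply: le_lt_trans; rewrite normrZ ger0_norm // ler_piMl.
  have [t t01 ->] : exists2 t : R, 0 <= t <= 1 &
      phi y - phi z = theta (z + t *: (y - z)) (y - z).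
    by apply: segment_MVT => t /seg/Hr[Ht _]; exact: lee_potentialP.
  rewrite (@linear_cspaceE R _ _ R^o (theta _)); last exact: (lc_theta_lin hC).
  rewrite (le_trans (ler_norm_sum _ _ _)) //; apply: ler_sum => k _.
  rewrite normrM ler_wpM2l // ltW //.
  by have [_ ->] := Hr _ (seg _ t01).
pose S y := \sum_k `|ccoef k (y - z)| * C k.
have cS : {for z, continuous S}.
  apply: continuous_sum => k; apply: cvgM; last exact: cvg_cst.
  apply: cvg_norm.
  have csub : {for z, continuous (fun y : E => y - z)}.
    by apply: cvgB; [exact: cvg_id|exact: cvg_cst].
  by apply: (continuous_comp csub); exact: ccoef_continuous.
have S0 : S z = 0.
  rewrite /S subrr big1 // => k _.
  by rewrite /ccoef; case: ifP => _; rewrite mxE normr0 mul0r.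
apply/cvgrPdist_lt => eps eps0.
have N1 : \forall y \near z, ball z r y by exact: nbhsx_ballx.
have N2 : \forall y \near z, `|S z - S y| < eps by move/cvgrPdist_lt : cS; apply.
apply: filterS2 N1 N2 => y zy; rewrite S0 sub0r normrN => /(le_lt_trans (ler_norm _)).
by rewrite distrC; apply: le_lt_trans; exact: bnd.
Unshelve. all: by end_near. Qed.

(** The difference has derivative 0 along the segment from z to z', by invariance of theta; the
    segment stays in the half space. *)
Lemma lee_potential_translate (x : R) A B C z z' : 0 < x -> L (Gmx x A B C) ->
  H z -> H z' ->
  phi (translate x A B C z) - phi z = phi (translate x A B C z') - phi z'.
Proof.
move=> x0 Ll Hz Hz'; pose T := translate x A B C; pose dT := trans_linear x B.
have Tline (t : R) : T (z + t *: (z' - z)) = T z + t *: dT (z' - z).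
  by rewrite /T /translate [z + _]addrC trans_linear_linear -addrA addrC.
pose F (t : R) := phi (T (z + t *: (z' - z))) - phi (z + t *: (z' - z)).
have HT y : H y -> H (T y) by move=> Hy; rewrite /H /= /T translateE alpha_of_mk mulr_gt0.
have dF (t : R) : 0 <= t <= 1 -> is_derive t 1 F 0.
  move=> t1; have Ht := alpha_of_segment Hz Hz' t1.
  have d1 : is_derive t 1 (fun s : R => phi (T z + s *: dT (z' - z)))
      (theta (z + t *: (z' - z)) (z' - z)).
    rewrite -(lc_theta_inv hC (z' - z) x0 Ll Ht) -/(T _) -/(dT _) Tline.
    apply/is_derive_lineP/lee_potentialP; rewrite -Tline; exact: HT.
  have d2 : is_derive t 1 (fun s : R => phi (z + s *: (z' - z)))
      (theta (z + t *: (z' - z)) (z' - z)).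
    have dphi := lee_potentialP (z' - z) Ht.
    exact: (is_derive_lineP phi z (z' - z) t _).2 dphi.
  have -> : F = (fun s : R => phi (T z + s *: dT (z' - z))) -
      (fun s : R => phi (z + s *: (z' - z))).
    by apply/funext => s; rewrite /F Tline.
  by apply: is_derive_eq; rewrite subrr.
have h1 (t : R) : t \in `]0, 1[ -> is_derive t 1 F 0.
  by move=> /subset_itv_oo_cc; rewrite in_itv; exact: dF.
have h2 : {within `[0, 1], continuous F}.
  apply: continuous_in_subspaceT => t; rewrite inE /= in_itv /= => /dF[d1 _].
  exact/differentiable_continuous/derivable1_diffP.
have [t _] := MVT_segment ler01 h1 h2.
rewrite /F mul0r scale0r addr0 scale1r [z + (z' - z)]addrC subrK => /eqP.
by rewrite subr_eq0 => /eqP ->.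
Qed.

Lemma translate_comp (x x' : R) A B C A' B' C' z :
  translate x A B C (translate x' A' B' C' z) =
  translate (x * x') (x *: A' + A) (B' + x' *: B) (C' + B *m A' + C) z.
Proof. by apply: of_coord_inj; rewrite !of_coord_translate mulmxA Gmx_mul. Qed.

Lemma alpha_of_translate (x : R) A B C z :
  alpha_of (translate x A B C z) = x * alpha_of z.
Proof. by rewrite translateE alpha_of_mk. Qed.

Lemma compact_slice (M : R) :
  compact ([set z : E | `|z| <= M] `&` [set z | alpha_of z = 1]).
Proof.
apply: compact_closedI; first exact: compact_cball.
rewrite (_ : mkset _ = (@alpha_of R m) @^-1` [set 1]) //.
apply: preimage_closed => [z _|]; first exact: alpha_of_continuous.
exact: (@closed_eq R 1).
Qed.

Variables (alpha : R) (nil : 'rV[R]_d -> 'cV[R]_d -> 'M[R]_d -> Prop).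
Hypothesis alpha_gt0 : 0 < alpha.
Hypothesis nilL : forall A B C, nil A B C -> L (Gmx 1 A B C).
Hypothesis alphaL : L (Gmx alpha 0 0 0).
Hypothesis nil_conj : forall A B C,
  nil A B C -> nil (alpha *: A) (alpha^-1 *: B) C.
Hypothesis nil_hom_trivial : forall l : 'rV[R]_d -> 'cV[R]_d -> 'M[R]_d -> R,
  (forall A B C A' B' C', nil A B C -> nil A' B' C' ->
     l (A' + A) (B' + B) (C' + B *m A' + C) = l A B C + l A' B' C') ->
  (forall A B C, nil A B C -> l (alpha *: A) (alpha^-1 *: B) C = l A B C) ->
  (forall M, exists K, forall C, `|C| <= M -> `|l 0 0 C| <= K) ->
  forall A B C, nil A B C -> l A B C = 0.
Hypothesis nil_cocompact : exists M, forall A B C, exists A' B' C',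
  [/\ nil A' B' C', `|A + A'| <= M, `|B + B'| <= M & `|C + B' *m A + C'| <= M].

Lemma lee_potential_invariant A B C z :
  nil A B C -> H z -> phi (translate 1 A B C z) = phi z.
Proof.
move=> nABC Hz; pose l A B C := phi (translate 1 A B C z1) - phi z1.
have Hz1 : H z1 by rewrite /H /= alpha_of_mk.
have lE A0 B0 C0 y : nil A0 B0 C0 -> H y ->
    phi (translate 1 A0 B0 C0 y) = l A0 B0 C0 + phi y.
  move=> /nilL Lg Hy; rewrite /l (lee_potential_translate ltr01 Lg Hz1 Hy).
  by rewrite subrK.
have Htr (x : R) A0 B0 C0 y : 0 < x -> H y -> H (translate x A0 B0 C0 y).
  by move=> x0 Hy; rewrite /H /= alpha_of_translate mulr_gt0.
rewrite lE // (_ : l A B C = 0) ?add0r //.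
apply: nil_hom_trivial nABC.
- move=> A0 B0 C0 A' B' C' n0 n'; rewrite {1}/l.
  have -> : translate 1 (A' + A0) (B' + B0) (C' + B0 *m A' + C0) z1 =
      translate 1 A0 B0 C0 (translate 1 A' B' C' z1).
    by rewrite translate_comp mulr1 !scale1r.
  by rewrite !lE // ?addrA ?addrK //; exact: Htr.
- move=> A0 B0 C0 n0; have n0' := nil_conj n0.
  (* Conjugation by g_0 written as a commutation rule. The constant by which g_0 changes phi occurs
     on both sides and cancels. *)
  have e1 : translate 1 (alpha *: A0) (alpha^-1 *: B0) C0 (translate alpha 0 0 0 z1) =
      translate alpha 0 0 0 (translate 1 A0 B0 C0 z1).
    rewrite !translate_comp mul1r mulr1 !scale1r mulmx0 !mul0mx.
    by rewrite scalerA mulfV ?gt_eqF // scale1r !addr0 !add0r.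
  have Ha : H (translate alpha 0 0 0 z1) by exact: Htr.
  have Hn : H (translate 1 A0 B0 C0 z1) by exact: Htr.
  have := lee_potential_translate alpha_gt0 alphaL Hz1 Hn.
  by rewrite -e1 !lE // => ?; lra.
(* The translates of z1 have t-coordinate 1, so their norm is at least 1 whatever M is. *)
- move=> M; pose M' := Num.max 1 M.
  have cphi y : ([set z : E | `|z| <= M'] `&` [set z | alpha_of z = 1]) y ->
      {for y, continuous phi}.
    by move=> [_ y_1]; apply: lee_potential_continuous; rewrite /H /= y_1.
  have [K K0 HK] := compact_continuous_bounded (@compact_slice M') cphi.
  exists (K + `|phi z1|) => C0 C0M; rewrite /l (le_trans (ler_normB _ _)) // lerD2r.
  apply: HK; split; last by rewrite /= alpha_of_translate alpha_of_mk mulr1.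
  rewrite /= translateE alpha_of_mk a_of_mk b_of_mk c_of_mk mulr1 !scale1r mul0mx !add0r.
  have M'1 : 1 <= M' by rewrite le_max lexx.
  apply: mk_coord_norm; rewrite ?normr1 ?normr0 ?(le_trans ler01) //.
  by rewrite /M' le_max C0M orbT.
Qed.

(** Cocompactness moves each point of the slice into one fixed compact set without changing the
    value of F. *)
Lemma slice_bounded (F : E -> R) :
  (forall z, H z -> {for z, continuous F}) ->
  (forall A B C z, nil A B C -> alpha_of z = 1 ->
     F (translate 1 A B C z) = F z) ->
  exists2 M, 0 <= M & forall z, alpha_of z = 1 -> `|F z| <= M.
Proof.
move=> cF Finv; have [M HM] := nil_cocompact.
have cFK z : ([set z : E | `|z| <= Num.max 1 M] `&` [set z | alpha_of z = 1]) z ->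
    {for z, continuous F}.
  by move=> [_ z_1]; apply: cF; rewrite /H /= z_1.
have [K K0 HK] := compact_continuous_bounded (@compact_slice (Num.max 1 M)) cFK.
exists K => // z z_1.
have [A' [B' [C' [n' hA hB hC']]]] := HM (a_of z) (b_of z) (c_of z).
rewrite -(Finv _ _ _ _ n' z_1); apply: HK; split; last first.
  by rewrite /= alpha_of_translate z_1 mulr1.
rewrite /= translateE z_1 mulr1 !scale1r.
by apply: mk_coord_norm; rewrite ?normr1 le_max ?lexx // ?hA ?hB ?hC' orbT.
Qed.

Hypothesis m_gt0 : (0 < m)%N.

(** Columns are counted from 0: these are the columns 2 and 3 of the overview, within range because
    m > 0. The vector [e_x] below, in the direction of c_11, is needed as - J e_r. *)
Let j1 : 'I_d := inord 1.
Let j2 : 'I_d := inord 2.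
Let e_r : E := mk_coord 0 0 (delta_mx ord0 0) 0.
Let e_s : E := mk_coord 0 (delta_mx 0 j1) 0 0.
Let e_q : E := mk_coord 0 0 0 (delta_mx ord0 j1).
Let e_y : E := mk_coord 0 0 0 (delta_mx ord0 j2).
Let e_x : E := mk_coord 0 0 0 (delta_mx ord0 ord0).

Let inordE (k l : nat) : (k < d)%N -> (l < d)%N ->
  (inord k == inord l :> 'I_d) = (k == l)%N.
Proof. by move=> kd ld; rewrite -val_eqE /= !inordK. Qed.

Let inord0 (k : nat) : (k < d)%N -> (inord k == ord0 :> 'I_d) = (k == 0)%N.
Proof. by move=> kd; rewrite -val_eqE /= inordK. Qed.

Lemma Jmap_e_y : Jmap e_y = e_q.
Proof.
congr pair; apply/matrixP => i j; have jm := ltn_ord j; rewrite !mxE;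
  case: unlift => [i'|]; rewrite ?(mxE, if_same, oppr0) //.
  rewrite !inordE; try lia.
  have -> : (j.*2 == 1)%N = false by lia.
  have -> : (j.*2.-1 == 2)%N = false by lia.
  by rewrite !andbF if_same oppr0.
rewrite !inordE; try lia.
rewrite -(val_eqE j) /=; case: (eqVneq (j : nat) 0%N) => [->|j0].
  by rewrite andbF.
by have -> : (j.*2 == 2)%N = (j.*2.-1 == 1)%N by lia.
Qed.

Lemma Jmap_e_r : Jmap e_r = - e_x.
Proof.
congr pair; apply/matrixP => i j; have jm := ltn_ord j; rewrite !mxE;
  case: unlift => [i'|]; rewrite ?(mxE, if_same, oppr0) //.
  rewrite inord0; last by lia.
  have -> : (j.*2 == 0)%N = (j == 0) by rewrite -(val_eqE j) /=; lia.
  by case: eqP => _; rewrite ?andbT ?andbF.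
rewrite inord0; last by lia.
rewrite -(val_eqE j) /=; case: (eqVneq (j : nat) 0%N) => [_|j0].
  by rewrite oppr0.
by have -> : (j.*2.-1 == 0)%N = false by [case: (nat_of_ord j) j0]; rewrite andbF mulr0n oppr0.
Qed.

Lemma mk_coord_addZ (x : R) t a b c t' a' b' c' :
  mk_coord t a b c + x *: mk_coord t' a' b' c' =
  mk_coord (t + x * t') (a + x *: a') (b + x *: b') (c + x *: c') :> E.
Proof.
rewrite addrC -mk_coord_linear.
by rewrite [x * t' + t]addrC [x *: a' + a]addrC [x *: b' + b]addrC [x *: c' + c]addrC.
Qed.

Lemma trans_linear_mk (x : R) B t a b c : trans_linear x B (mk_coord t a b c) =
  mk_coord (x * t) (x *: a) (b + t *: B) (c + B *m a).
Proof. by rewrite /trans_linear alpha_of_mk a_of_mk b_of_mk c_of_mk. Qed.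

Let Glin := lc_lin hC.
Let Gsym := lc_sym hC.

Lemma G0 z v : G z 0 v = 0.
Proof. by have := Glin z 1 0 0 v; rewrite scale1r addr0 mul1r => ?; lra. Qed.

Lemma GN z u v : G z (- u) v = - G z u v.
Proof. by rewrite -scaleN1r -[_ *: u]addr0 Glin G0 addr0 mulN1r. Qed.

Lemma Jmap2 u : Jmap (Jmap u) = - u.
Proof. by case: u => x y. Qed.

Lemma fundamental_anti z u v : G z (Jmap u) v = - G z (Jmap v) u.
Proof. by rewrite -(lc_J hC) Jmap2 GN Gsym. Qed.

Lemma GJ_y z v : G z (Jmap v) e_y = - G z e_q v.
Proof. by rewrite fundamental_anti Jmap_e_y. Qed.

Lemma GJ_r z v : G z (Jmap e_r) v = - G z e_x v.
Proof. by rewrite Jmap_e_r GN. Qed.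

(** The LCK equation on (e_r, v, e_y) with all signs reversed. J-invariance turns omega(v, e_y),
    omega(e_r, e_y) and omega(e_r, v) into - g(e_q, v), - g(e_q, e_r) and - g(e_x, v). *)
Lemma lck_identity z v : H z ->
  'D_e_r (fun z => G z e_q v) z - 'D_v (fun z => G z e_q e_r) z
    + 'D_e_y (fun z => G z e_x v) z =
  theta z e_r * G z e_q v - theta z v * G z e_q e_r + theta z e_y * G z e_x v.
Proof.
move=> Hz; have := lc_lck hC e_r v e_y Hz; rewrite /ext_d2 /wedge12 !GJ_y GJ_r.
have DN u w w' : 'D_u (fun z => - G z w w') z = - 'D_u (fun z => G z w w') z.
  by apply: deriveN; apply: diff_derivable; exact: (lc_dif hC).
have -> : (fun y => G y (Jmap v) e_y) = (fun y => - G y e_q v).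
  by apply/funext => y; exact: GJ_y.
have -> : (fun y => G y (Jmap e_r) e_y) = (fun y => - G y e_q e_r).
  by apply/funext => y; exact: GJ_y.
have -> : (fun y => G y (Jmap e_r) v) = (fun y => - G y e_x v).
  by apply/funext => y; exact: GJ_r.
by rewrite !DN !mulrN => ?; lra.
Qed.

Let B0 z : R := b_of z ord0 0.
Let ex z : R := expR (- phi z).

Lemma B0_derive z v : is_derive z v B0 (B0 v).
Proof.
rewrite -[z]addr0 -[X in z + X](scale0r v); apply/is_derive_lineP.
have -> : (fun s : R => B0 (z + s *: v)) = cst (B0 z) + (id * cst (B0 v)).
  by apply/funext => s; rewrite /B0 addrC b_of_linear !mxE fctE /= fctE addrC.
apply: (is_derive_eq (is_deriveD (is_derive_cst _ _ _)
  (is_deriveM (is_derive_id _ _) (is_derive_cst _ _ _)))).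
by rewrite /GRing.scale /= !mulr0 mulr1 !add0r.
Qed.

Lemma B0_continuous : continuous B0.
Proof.
apply: (linear_continuous_cspace (W := R^o) (f := B0)) => k u v.
by rewrite /B0 b_of_linear [LHS]mxE [X in X + _]mxE.
Qed.

Lemma ex_derive z v : H z -> is_derive z v ex (- theta z v * ex z).
Proof.
move=> Hz; have dphi := lee_potentialP v Hz.
rewrite -[X in is_derive X]addr0 -[X in z + X](scale0r v).
apply/is_derive_lineP.
have h1 : is_derive (0 : R) 1 (fun s : R => phi (z + s *: v)) (theta z v).
  by apply/is_derive_lineP; rewrite scale0r addr0.
have h2 : is_derive (0 : R) 1 (- (fun s : R => phi (z + s *: v))) (- theta z v).
  exact: is_deriveN.
apply: (is_derive_eq (is_derive1_comp (is_derive_expR _) h2)).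
by rewrite fctE scale0r addr0 mulrC.
Qed.

Lemma ex_continuous z : H z -> {for z, continuous ex}.
Proof.
move=> Hz; have c1 : {for z, continuous (fun z => - phi z)}.
  by apply: cvgN; exact: lee_potential_continuous.
by apply: (continuous_comp c1); exact: continuous_expR.
Qed.

Lemma ex_invariant A B C z : nil A B C -> H z -> ex (translate 1 A B C z) = ex z.
Proof. by move=> n Hz; rewrite /ex (lee_potential_invariant n). Qed.

(** Invariance under translations requires all the b_i, although only b_1 can be nonzero on the box
    of [no_lck_cover]. *)
Let Afield z : E := mk_coord 0 (delta_mx 0 j1) 0 (b_of z *m delta_mx 0 j1).

Lemma Afield_continuous : continuous Afield.
Proof.
have -> : Afield = fun z => e_s + mk_coord 0 0 0 (b_of z *m delta_mx 0 j1).
  apply/funext => z; rewrite -[e_s]scale1r -mk_coord_linear.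
  by rewrite mulr0 !scale1r !addr0 add0r.
move=> z; apply: cvgD; first exact: cvg_cst.
apply: (linear_continuous_cspace
  (f := fun z => mk_coord 0 0 0 (b_of z *m delta_mx 0 j1))) => k u v.
by rewrite -mk_coord_linear b_of_linear mulmxDl -scalemxAl !scaler0 mulr0 !addr0.
Qed.

Lemma G_continuous u v z : H z -> {for z, continuous (fun z => G z u v)}.
Proof.
by move=> Hz; apply: differentiable_continuous; exact: (lc_dif hC).
Qed.

Lemma G_Afield_continuous u z : H z ->
  {for z, continuous (fun z => G z u (Afield z))}.
Proof.
move=> Hz; apply: (@continuous_pairing (fun z v => G z u v)).
- by move=> y k v w; rewrite ![G y u _]Gsym Glin.
- by move=> v; exact: G_continuous.
- exact: Afield_continuous.
Qed.

Lemma G_invariant A B C z u v : nil A B C -> H z ->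
  G (translate 1 A B C z) (trans_linear 1 B u) (trans_linear 1 B v) = G z u v.
Proof. by move=> /nilL Lg Hz; exact: (lc_inv hC). Qed.

Lemma trans_vertical B c : trans_linear 1 B (mk_coord 0 0 0 c) = mk_coord 0 0 0 c.
Proof. by rewrite trans_linear_mk mulr0 !scaler0 mulmx0 scale0r !addr0. Qed.

Lemma trans_e_r B : trans_linear 1 B e_r = e_r.
Proof. by rewrite trans_linear_mk mulr0 !scaler0 mulmx0 scale0r !addr0. Qed.

Lemma trans_Afield A B C z : alpha_of z = 1 ->
  trans_linear 1 B (Afield z) = Afield (translate 1 A B C z).
Proof.
move=> z_1; rewrite trans_linear_mk translateE /Afield b_of_mk z_1 mulmxDl.
by rewrite mulr0 !scale1r scale0r !addr0.
Qed.

Lemma H_of_slice z : alpha_of z = 1 -> H z.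
Proof. by rewrite /H /= => ->. Qed.

Lemma bound_e_r : exists2 M, 0 <= M &
  forall z, alpha_of z = 1 -> `|ex z * G z e_q e_r| <= M.
Proof.
apply: slice_bounded => [z Hz|A B C z n z_1].
  by apply: cvgM; [exact: ex_continuous|exact: G_continuous].
have Hz := H_of_slice z_1; rewrite (ex_invariant n) //; congr (_ * _).
by rewrite -(G_invariant e_q e_r n Hz) trans_vertical trans_e_r.
Qed.

Lemma bound_Afield c : exists2 M, 0 <= M & forall z, alpha_of z = 1 ->
  `|ex z * G z (mk_coord 0 0 0 c) (Afield z)| <= M.
Proof.
apply: slice_bounded => [z Hz|A B C z n z_1].
  by apply: cvgM; [exact: ex_continuous|exact: G_Afield_continuous].
have Hz := H_of_slice z_1; rewrite (ex_invariant n) //; congr (_ * _).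
by rewrite -(G_invariant _ (Afield z) n Hz) trans_vertical (trans_Afield A B C z_1).
Qed.

Lemma e_q_neq0 : e_q != 0.
Proof.
apply/eqP => /(congr1 (@c_of R m)); rewrite c_of_mk => /matrixP/(_ ord0 j1).
rewrite mxE !eqxx /c_of mxE /coord_row; case: ifP => _; rewrite mxE => /eqP;
by rewrite oner_eq0.
Qed.

(** [slice_bounded] yields upper bounds only, so it is applied to the inverse, which is again
    continuous and invariant. *)
Lemma lower_bound : exists2 eps, 0 < eps &
  forall z, alpha_of z = 1 -> eps <= ex z * G z e_q e_q.
Proof.
have pos z : H z -> 0 < ex z * G z e_q e_q.
  by move=> Hz; rewrite mulr_gt0 ?expR_gt0 // (lc_pos hC) // e_q_neq0.
have [M M0 HM] : exists2 M, 0 <= M &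
    forall z, alpha_of z = 1 -> `|(ex z * G z e_q e_q)^-1| <= M.
  apply: slice_bounded => [z Hz|A B C z n z_1].
    apply: cvgV; first by rewrite gt_eqF // pos.
    by apply: cvgM; [exact: ex_continuous|exact: G_continuous].
  have Hz := H_of_slice z_1; rewrite (ex_invariant n) //; congr ((_ * _)^-1).
  by rewrite -(G_invariant e_q e_q n Hz) trans_vertical.
exists (M + 1)^-1; first by rewrite invr_gt0 ltr_wpDl.
move=> z z_1; have p := pos _ (H_of_slice z_1).
rewrite -[leRHS]invrK lef_pV2 ?posrE ?invr_gt0 ?ltr_wpDl //.
rewrite (le_trans (ler_norm _)) // (le_trans (HM _ z_1)) // lerDl //.
Qed.

Let gqr z := G z e_q e_r.
Let gqs z := G z e_q e_s.
Let gqq z := G z e_q e_q.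
Let gxs z := G z e_x e_s.
Let gxq z := G z e_x e_q.

(** The negative of the field of the overview, so that its divergence is positive. The field e_s +
    [B0] e_q stands for A; the two agree where the other b_i vanish, in particular on the box. *)
Let X_r z := ex z * (gqs z + B0 z * gqq z).
Let X_s z := - (ex z * gqr z).
Let X_q z := - (B0 z * (ex z * gqr z)).
Let X_y z := ex z * (gxs z + B0 z * gxq z).

Let Y_r z := ex z * (- theta z e_r * (gqs z + B0 z * gqq z)
  + ('D_e_r gqs z + (gqq z + B0 z * 'D_e_r gqq z))).
Let Y_s z := - (ex z * (- theta z e_s * gqr z + 'D_e_s gqr z)).
Let Y_q z := - (B0 z * (ex z * (- theta z e_q * gqr z + 'D_e_q gqr z))).
Let Y_y z := ex z * (- theta z e_y * (gxs z + B0 z * gxq z)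
  + ('D_e_y gxs z + B0 z * 'D_e_y gxq z)).

Let G_derive u v w z : H z -> is_derive z w (fun z => G z u v) ('D_w (fun z => G z u v) z).
Proof.
by move=> Hz; apply/derivableP/diff_derivable; exact: (lc_dif hC).
Qed.

Let B0_e_r : B0 e_r = 1. Proof. by rewrite /B0 b_of_mk mxE !eqxx. Qed.
Let B0_e_q : B0 e_q = 0. Proof. by rewrite /B0 b_of_mk mxE. Qed.
Let B0_e_y : B0 e_y = 0. Proof. by rewrite /B0 b_of_mk mxE. Qed.

Lemma X_derive z : H z -> [/\ is_derive z e_r X_r (Y_r z),
  is_derive z e_s X_s (Y_s z), is_derive z e_q X_q (Y_q z) &
  is_derive z e_y X_y (Y_y z)].
Proof.
move=> Hz; have dB := B0_derive z; have dex w := ex_derive w Hz.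
have d1 w : is_derive z w gqs ('D_w gqs z) := G_derive e_q e_s w Hz.
have d2 w : is_derive z w gqq ('D_w gqq z) := G_derive e_q e_q w Hz.
have d3 w : is_derive z w gqr ('D_w gqr z) := G_derive e_q e_r w Hz.
have d4 w : is_derive z w gxs ('D_w gxs z) := G_derive e_x e_s w Hz.
have d5 w : is_derive z w gxq ('D_w gxq z) := G_derive e_x e_q w Hz.
split.
- have -> : X_r = ex * (gqs + B0 * gqq) by [].
  have := is_deriveM (dex e_r) (is_deriveD (d1 e_r) (is_deriveM (dB e_r) (d2 e_r))).
  by move=> h; apply: (is_derive_eq h); rewrite B0_e_r /Y_r !fctE /GRing.scale /=; ring.
- have -> : X_s = - (ex * gqr) by [].
  have := is_deriveN (is_deriveM (dex e_s) (d3 e_s)).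
  by move=> h; apply: (is_derive_eq h); rewrite /Y_s /GRing.scale /=; ring.
- have -> : X_q = - (B0 * (ex * gqr)) by [].
  have := is_deriveN (is_deriveM (dB e_q) (is_deriveM (dex e_q) (d3 e_q))).
  by move=> h; apply: (is_derive_eq h); rewrite B0_e_q /Y_q !fctE /GRing.scale /=; ring.
- have -> : X_y = ex * (gxs + B0 * gxq) by [].
  have := is_deriveM (dex e_y) (is_deriveD (d4 e_y) (is_deriveM (dB e_y) (d5 e_y))).
  by move=> h; apply: (is_derive_eq h); rewrite B0_e_y /Y_y !fctE /GRing.scale /=; ring.
Qed.

(** The surviving term comes from the derivative of [B0] along e_r, that is, from [e_r, A] = e_q.
    The rest is [lck_identity] at e_s plus [B0] times [lck_identity] at e_q, the theta terms being
    supplied by the derivative of exp(- phi). *)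
Lemma divergence_X z : H z -> Y_r z + Y_s z + Y_q z + Y_y z = ex z * gqq z.
Proof.
move=> Hz.
have I1 : 'D_e_r gqs z - 'D_e_s gqr z + 'D_e_y gxs z =
    theta z e_r * gqs z - theta z e_s * gqr z + theta z e_y * gxs z.
  exact: lck_identity.
have I2 : 'D_e_r gqq z - 'D_e_q gqr z + 'D_e_y gxq z =
    theta z e_r * gqq z - theta z e_q * gqr z + theta z e_y * gxq z.
  exact: lck_identity.
move: I1 I2; rewrite /Y_r /Y_s /Y_q /Y_y.
move: ('D_e_r gqs z) ('D_e_s gqr z) ('D_e_y gxs z) ('D_e_r gqq z) ('D_e_q gqr z)
  ('D_e_y gxq z) (theta z e_r) (theta z e_s) (theta z e_q) (theta z e_y)
  (gqr z) (gqs z) (gqq z) (gxs z) (gxq z) (B0 z) (ex z)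
  => rqs sqr yxs rqq qqr yxq tr ts tq ty qr qs qq xs xq b0 x I1 I2.
have -> : x * (- tr * (qs + b0 * qq) + (rqs + (qq + b0 * rqq)))
    + - (x * (- ts * qr + sqr)) + - (b0 * (x * (- tq * qr + qqr)))
    + x * (- ty * (xs + b0 * xq) + (yxs + b0 * yxq)) =
  x * (qq + ((rqs - sqr + yxs) - (tr * qs - ts * qr + ty * xs))
       + b0 * ((rqq - qqr + yxq) - (tr * qq - tq * qr + ty * xq))) by ring.
by rewrite I1 I2 !subrr mulr0 !addr0.
Qed.

Lemma Y_continuous z : H z -> [/\ {for z, continuous Y_r}, {for z, continuous Y_s},
  {for z, continuous Y_q} & {for z, continuous Y_y}].
Proof.
move=> Hz; have cex := ex_continuous Hz; have cB := @B0_continuous z.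
have cth u : {for z, continuous (fun z => - theta z u)}.
  by apply: cvgN; apply: differentiable_continuous; exact: (lc_theta_dif hC).
have cG u v : {for z, continuous (fun z => G z u v)} by exact: G_continuous.
have cD u v w : {for z, continuous ('D_w (fun y => G y u v))}.
  exact: (lc_C1 hC).
have cGB u v w : {for z, continuous (fun z => G z u v + B0 z * G z u w)}.
  by apply: cvgD; [exact: cG|apply: cvgM; [exact: cB|exact: cG]].
split.
- apply: cvgM; first exact: cex.
  apply: cvgD; first by apply: cvgM; [exact: cth|exact: cGB].
  apply: cvgD; first exact: cD.
  by apply: cvgD; [exact: cG|apply: cvgM; [exact: cB|exact: cD]].
- apply: cvgN; apply: cvgM; first exact: cex.
  by apply: cvgD; [apply: cvgM; [exact: cth|exact: cG]|exact: cD].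
- apply: cvgN; apply: cvgM; first exact: cB.
  apply: cvgM; first exact: cex.
  by apply: cvgD; [apply: cvgM; [exact: cth|exact: cG]|exact: cD].
- apply: cvgM; first exact: cex.
  apply: cvgD; first by apply: cvgM; [exact: cth|exact: cGB].
  by apply: cvgD; [exact: cD|apply: cvgM; [exact: cB|exact: cD]].
Qed.

Lemma no_lck_cover : False.
Proof.
have [eps eps0 Heps] := lower_bound.
have [M1 M10 HM1] := bound_Afield (delta_mx ord0 j1).
have [M2 M20 HM2] := bound_e_r.
have [M4 M40 HM4] := bound_Afield (delta_mx ord0 ord0).
(* The summand 1 makes l positive and 8 M / l strictly smaller than eps. *)
pose M := M1 + M2 + M4; pose l := (8 * M + 1) / eps.
have M0 : 0 <= M by rewrite !addr_ge0.
have l0 : 0 < l by rewrite divr_gt0 // ltr_wpDl // mulr_ge0.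
have boxE x1 x2 x3 x4 : boxpt z1 e_r e_s e_q e_y x1 x2 x3 x4 =
    mk_coord 1 (x2 *: delta_mx 0 j1) (x1 *: delta_mx ord0 0)
      (x3 *: delta_mx ord0 j1 + x4 *: delta_mx ord0 j2).
  by rewrite /boxpt !mk_coord_addZ !(mulr0, scaler0, addr0, add0r).
pose rho := `|z1| + l * `|e_r| + l * `|e_s| + l ^+ 2 * `|e_q| + l * `|e_y|.
pose K : set E := [set z | `|z| <= rho] `&` [set z | alpha_of z = 1].
have cK : compact K by exact: compact_slice.
have KH z : K z -> H z by move=> [_ z_1]; exact: H_of_slice.
have bK : box z1 e_r e_s e_q e_y l l (l ^+ 2) l `<=` K.
  move=> p [x1 [x2 [x3 [x4 [/andP[a1 b1] /andP[a2 b2] /andP[a3 b3] /andP[a4 b4] ->]]]]].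
  split; last by rewrite /= boxE alpha_of_mk.
  rewrite /= /boxpt.
  by do 4 (apply: (le_trans (ler_normD _ _)); apply: lerD;
    last by rewrite normrZ ger0_norm // ler_wpM2r).
have l20 : 0 < l ^+ 2 by rewrite exprn_gt0.
(* The q-component carries the unbounded factor b_1 <= l. The longer side l^2 in that direction
   compensates it, so that all four contributions are 2 M / l. *)
have := @divergence_box R E z1 e_r e_s e_q e_y l l (l ^+ 2) l M M (l * M) M eps
  l0 l0 l20 l0 X_r X_s X_q X_y Y_r Y_s Y_q Y_y K cK bK.
have Yc z : K z -> _ := fun Kz => Y_continuous (KH z Kz).
move=> /(_ (fun z Kz => let: And4 c _ _ _ := Yc z Kz in c)).
move=> /(_ (fun z Kz => let: And4 _ c _ _ := Yc z Kz in c)).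
move=> /(_ (fun z Kz => let: And4 _ _ c _ := Yc z Kz in c)).
move=> /(_ (fun z Kz => let: And4 _ _ _ c := Yc z Kz in c)).
have bD p : box z1 e_r e_s e_q e_y l l (l ^+ 2) l p -> _ :=
  fun bp => X_derive (KH p (bK p bp)).
move=> /(_ bD).
have bM p : box z1 e_r e_s e_q e_y l l (l ^+ 2) l p ->
    [/\ `|X_r p| <= M, `|X_s p| <= M, `|X_q p| <= l * M & `|X_y p| <= M].
  move=> bp; have [_ p_1] := bK p bp; have Hp := H_of_slice p_1.
  move: bp => [x1 [x2 [x3 [x4 [/andP[a1 b1] _ _ _ pE]]]]].
  have B0p : B0 p = x1 by rewrite /B0 pE boxE b_of_mk !mxE !eqxx mulr1.
  have Ap : Afield p = e_s + B0 p *: e_q.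
    rewrite mk_coord_addZ !(mulr0, scaler0, addr0, add0r) B0p /Afield pE boxE b_of_mk.
    by rewrite -scalemxAl mul_delta_mx.
  have GA u : G p u (Afield p) = G p u e_s + B0 p * G p u e_q.
    by rewrite Ap addrC ![G p u _]Gsym Glin addrC.
  have := HM1 p p_1; have := HM2 p p_1; have := HM4 p p_1; rewrite !GA => h4 h2 h1.
  have h2' : `|ex p * gqr p| <= M by apply: (le_trans h2); rewrite /M; lra.
  split.
  - by apply: (le_trans h1); rewrite /M; lra.
  - by rewrite normrN.
  - by rewrite normrN normrM B0p ger0_norm // ler_pM.
  - by apply: (le_trans h4); rewrite /M; lra.
move=> /(_ bM).
have bY p : box z1 e_r e_s e_q e_y l l (l ^+ 2) l p ->
    eps <= Y_r p + Y_s p + Y_q p + Y_y p.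
  move=> bp; have [_ p_1] := bK p bp.
  rewrite divergence_X; first exact: (Heps p p_1).
  exact: H_of_slice.
move=> /(_ bY).
have -> : 2 * M / l + 2 * M / l + 2 * (l * M) / l ^+ 2 + 2 * M / l = 8 * M / l.
  by field; rewrite gt_eqF.
rewrite leNgt => /negP; apply.
by rewrite ltr_pdivrMr // /l mulrCA mulfV ?gt_eqF // mulr1 ltrDl.
Qed.

End Analysis.

Theorem proposition5p1 (R : realType) (d m : nat)
  (hdm : d = (2 * m + 1)%N) (hd : (1 < d)%N)
  (N : 'M[int]_(2 * d)) (alpha : R)
  (hdet : \det N = 1)
  (hdiag : diagonalizable (map_mx intr N : 'M[R]_(2 * d)))
  (hchar : char_poly (map_mx intr N : 'M[R]_(2 * d)) =
           ('X - alpha%:P) ^+ d * ('X - alpha^-1%:P) ^+ d)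
  (halpha : 1 < alpha) (hquad : quadratic_integer alpha)
  (a b : 'M[R]_(d, 2 * d))
  (ha : eigenbasis (map_mx intr N) alpha a)
  (hb : eigenbasis (map_mx intr N) alpha^-1 b)
  (D : set 'M[R]_(d + (1 + d))) (h : 'I_(d ^ 2) -> 'M[R]_d)
  (hD : cocompact_lattice (@Zcenter R d) D)
  (hDz : forall s t : 'I_(2 * d), D (Gmx 1 0 0 (emx a b s t)))
  (hDgen : D = generated (range (fun k => Gmx 1 0 0 (h k))))
  (P : 'M[int]_(2 * d, d ^ 2))
  (c : 'I_(2 * d) -> 'M[R]_d)
  (hc : forall (k : 'I_(2 * d)) (i j : 'I_d),
    c k i j = \sum_s (N k s)%:~R * c s i j + fmx N a b k i j
              + \sum_l (P k l)%:~R * h l i j) :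
  ~ exists g, lck_metric (quotient_atlas (m := m) (Lambda alpha a b c h)) g.
Proof.
move=> [g lck]; move: hdm; rewrite addn1 => dE; subst d.
have m_gt0 : (0 < m)%N by move: hd; rewrite ltnS muln_gt0.
have [e e0 hnil] : exists2 e, 0 < e & forall A B C, nilgrp a b D c A B C ->
    `|A| < e -> `|B| < e -> [/\ A = 0, B = 0 & `|C| < e -> C = 0].
  by eapply nilgrp_discrete; eassumption.
have Lnil l : Lambda alpha a b c h l -> exists n A B C,
    nilgrp a b D c A B C /\ l = Gmx (alpha ^ n) (alpha ^ n *: A) B C.
  by eapply Lambda_nilgrp; eassumption.
have nilL A B C : nilgrp a b D c A B C -> Lambda alpha a b c h (Gmx 1 A B C).
  by eapply nilgrp_Lambda; eassumption.
have Linj := locally_free halpha Lnil e0 hnil.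
have [G [theta hC]] := lck_pullback (generated1 _) (@generatedM _ _ _)
  (@generatedV _ _ _) Linj lck.
have [phi phiP] := lee_potential_exists hC.
have nilconj A B C : nilgrp a b D c A B C ->
    nilgrp a b D c (alpha *: A) (alpha^-1 *: B) C.
  by eapply nilgrp_conj; eassumption.
apply: (no_lck_cover hC phiP (lt_trans ltr01 halpha) nilL _ nilconj) => //.
- by apply: generated_in; left; left.
- move=> l lM lconj lbnd; eapply nilgrp_hom_trivial; try eassumption.
  by move=> M; have [K HK] := lbnd M; exists K => C _; exact: HK.
- by eapply nilgrp_cocompact; eassumption.
Qed.
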